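(* Let the Structural Assumptions (A1)–(A8) listed in the context hold with some reflexive space $U$ continuously embedded in $L^p(\Omega)$ for some $1\le p\le\infty$, let $A:U\to U^*$ be an isomorphism, $f_0\in L^{p/(p-1)}(\Omega)$ and $f_1\in U^*$. Consider the problems $$(\mathrm{I}_{\delta})\qquad \min_{u\in U,\,w}\ \|Tu-y^\delta\|_Y\quad\text{subject to}\quad Au+f_0uw=f_1,\ \ w\in W^{\mathrm{ad}}_h$$ and $$(\mathrm{McC}_\delta)\qquad \min_{u\in U,\,w,\,z}\ \|Tu-y^\delta\|_Y\quad\text{subject to}\quad Au+f_0z=f_1,\ \ \mathrm{mcc}(u,w,z)\le0\ \text{a.e. in }\Omega,\ \ w\in\mathrm{conv}\,W^{\mathrm{ad}}_h,\ z\in Z^{\mathrm{ad}},$$ where $\mathrm{mcc}(u,w,z)\le 0$ denotes the four inequalities given in the context. Then $(\mathrm{McC}_\delta)$ is a convex minimization problem that admits a minimizer. If $(u,w)\in U\times W^{\mathrm{ad}}_h$ is feasible for $(\mathrm{I}_\delta)$, then $(u,w,uw)\in U\times W^{\mathrm{ad}}_h\times Z^{\mathrm{ad}}$ is feasible for $(\mathrm{McC}_\delta)$ and the objective values coincide.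
   Context: Setting. $\Omega\subset\mathbb{R}^d$, $d\in\mathbb{N}$, is a bounded Lipschitz domain; $U$ is continuously embedded in $L^2(\Omega)$; $A$ is linear; $T:L^2(\Omega)\to Y$ is a bounded linear observation operator into a Banach space $Y$; $y^\delta\in Y$; $f_0\ge0$. $w_\ell,w_u\in L^\infty(\Omega)$ are given, and $W^{\mathrm{ad}}$ is a nonempty subset of $\{w\in L^\infty(\Omega): w_\ell\le w\le w_u \text{ a.e. in }\Omega\}$. McCormick inequalities. With $u_\ell,u_u$ from (A3) below, $\mathrm{mcc}(u,w,z)\le0$ means: $u_\ell w+uw_\ell-u_\ell w_\ell-z\le0$, $\ u_uw+uw_u-u_uw_u-z\le0$, $\ z-u_uw-uw_\ell+u_uw_\ell\le0$, $\ z-u_\ell w-uw_u+u_\ell w_u\le0$. Meshes and projections. $\mathcal{Q}_h=\{Q_h^1,\dots,Q_h^{N_h}\}$ and $\mathcal{Q}_\tau=\{Q_\tau^1,\dots,Q_\tau^{N_\tau}\}$ are finite partitions of $\Omega$ with mesh sizes $h$ and $\tau$. $V_h$ is the discretization set for $w$, defined on $\mathcal{Q}_h$, and $W^{\mathrm{ad}}_h=W^{\mathrm{ad}}\cap V_h$. $P_{V_h}$ and $P_{W_h^{\mathrm{ad}}}$ are the $L^2(\Omega)$-metric projections onto $V_h$ and $W^{\mathrm{ad}}_h$. $P_\tau$ is local averaging: $(P_\tau v)|_{Q_\tau^i}=|Q_\tau^i|^{-1}\int_{Q_\tau^i}v\,dx$. State equations: (E) $Au+f_0uw=f_1$; (E$_\tau$)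 $Au+f_0(P_\tau u)(P_\tau w)=f_1$. Structural Assumptions. (A1) $V_h$ is a closed convex subset of a finite-dimensional ansatz space for $L^2(\Omega)$. (A2) For all $w\in W^{\mathrm{ad}}$, (E) and (E$_\tau$) admit unique solutions in $U$. (A3) There are $u_\ell,u_u\in L^\infty(\Omega)$ such that for all $w\in W^{\mathrm{ad}}$ the solution $u$ of (E) satisfies $u_\ell\le u\le u_u$ a.e. in $\Omega$. (A4) There are $u_\ell^i,u_u^i\in\mathbb{R}$ such that for all $w\in W^{\mathrm{ad}}$ the solution $u$ of (E$_\tau$) satisfies $u_\ell^i\le P_\tau u\le u_u^i$ a.e. in $Q_\tau^i$, $i=1,\dots,N_\tau$. (A5) There are $w_\ell^i,w_u^i\in\mathbb{R}$ such that for all $w\in W^{\mathrm{ad}}_h$, $w_\ell^i\le P_\tau w\le w_u^i$ a.e. in $Q_\tau^i$, $i=1,\dots,N_\tau$. (A6) $P_{V_h}w=P_{W^{\mathrm{ad}}_h}w$ for all $w\in W^{\mathrm{ad}}$. (A7) $Z^{\mathrm{ad}}$ is a closed, convex, bounded subset of $L^\infty(\Omega)$, and $uw\in Z^{\mathrm{ad}}$ whenever $u$ solves (E) for $w\in W^{\mathrm{ad}}_h$. (A8) $Z^{\mathrm{ad}}_\tau$ is a closed, convex, bounded subset of $L^\infty(\Omega)$ consisting of piecewise constant functions on $\mathcal{Q}_\tau$, and $(P_\tau u)(P_\tau w)\in Z^{\mathrm{ad}}_\tau$ whenever $u$ solves (E$_\tau$) for $w\in W^{\mathrm{ad}}_h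$.
   Formalization: In (A7), Z^ad is assumed weak-* closed in L^∞ rather than norm closed: with norm closedness a minimizer may fail to exist (e.g. Z^ad bounded continuous functions). The L²-metric projection onto W_h^ad is taken to exist on all of L². *)

(* Defs.v *)
From HB Require Import structures.
From mathcomp Require Import all_boot all_order all_algebra.
From mathcomp Require Import all_classical all_reals all_analysis.
From mathcomp Require Import generic_quotient measurable_realfun.

Set Implicit Arguments.
Unset Strict Implicit.
Unset Printing Implicit Defensive.

Import Order.TTheory GRing.Theory Num.Theory.
Import numFieldNormedType.Exports.

Local Open Scope classical_set_scope.
Local Open Scope ring_scope.

Section iterated_product.
Context d (T : measurableType d) (R : realType).
Variable m1 : {sigma_finite_measure set T -> \bar R}.

Definition tuple_cons n (p : T * n.-tuple T) : n.+1.-tuple T :=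
  [tuple of p.1 :: p.2].

Lemma measurable_tuple_cons n : measurable_fun setT (@tuple_cons n).
Proof. exact: measurable_cons. Qed.

Section step.
Variables (n : nat) (m : {sigma_finite_measure set (n.-tuple T) -> \bar R}).

Definition product_step : set (n.+1.-tuple T) -> \bar R :=
  pushforward (m1 \x m)%E (@tuple_cons n).

Let product_step0 : product_step set0 = 0%E.
Proof. by rewrite /product_step /pushforward preimage_set0 measure0. Qed.

Let product_step_ge0 A : (0 <= product_step A)%E.
Proof. by rewrite /product_step /pushforward; exact: measure_ge0. Qed.

Let product_step_sigma_additive : semi_sigma_additive product_step.
Proof.
move=> F mF tF mUF; rewrite /product_step /pushforward preimage_bigcup.
have mp A : measurable A -> measurable (@tuple_cons n @^-1` A).
  by move=> mA; rewrite -[X in measurable X]setTI; exact: measurable_tuple_cons.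
apply: measure_semi_sigma_additive.
- by move=> k; exact: mp.
- apply/trivIsetP => /= i j _ _ ij; rewrite -preimage_setI.
  by move/trivIsetP : tF => /(_ _ _ _ _ ij) ->//; rewrite preimage_set0.
- by rewrite -preimage_bigcup; exact: mp.
Qed.

HB.instance Definition _ := isMeasure.Build _ _ _ product_step
  product_step0 product_step_ge0 product_step_sigma_additive.

Let product_step_sigma_finite : sigma_finite setT product_step.
Proof.
have /sigma_finiteP[F [FT ndF Foo]] := sigma_finiteT m1.
have /sigma_finiteP[G [GT ndG Goo]] := sigma_finiteT m.
pose g (t : n.+1.-tuple T) : T * n.-tuple T := (thead t, [tuple of behead t]).
have mg : measurable_fun setT g.
  by apply/measurable_fun_pair; [exact: measurable_tnth|exact: measurable_behead].
exists (fun k => g @^-1` (F k `*` G k)).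
  rewrite -preimage_bigcup; apply/esym/seteqP; split => // t _ /=.
  have : setT (thead t) by []. rewrite FT => -[i _ Fi].
  have : setT [tuple of behead t] by []. rewrite GT => -[j _ Gj].
  exists (maxn i j) => //; split => /=.
    by move: Fi; exact/subsetPset/ndF/leq_maxl.
  by move: Gj; exact/subsetPset/ndG/leq_maxr.
move=> k; have [mF Fk] := Foo k; have [mG Gk] := Goo k; split.
  by rewrite -[X in measurable X]setTI; apply: mg => //; exact: measurableX.
rewrite /product_step /pushforward -comp_preimage.
rewrite (_ : g \o @tuple_cons n = id); last first.
  by apply/funext => -[a b]; rewrite /g /=; congr (_, _); exact/val_inj.
by rewrite preimage_id product_measure1E// lte_mul_pinfty// ge0_fin_numE.
Qed.

HB.instance Definition _ := Measure_isSigmaFinite.Build _ _ _ product_step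
  product_step_sigma_finite.

End step.

Fixpoint iterated_product n : {sigma_finite_measure set (n.-tuple T) -> \bar R} :=
  match n with
  | 0%N => \d_ ([tuple] : 0.-tuple T)
  | k.+1 => product_step (iterated_product k)
  end.

End iterated_product.

(* R^d is the space of row vectors with its Borel sigma-algebra. *)
Definition Rn (R : realType) (d : nat) : Type :=
  g_sigma_algebraType (@open 'rV[R]_d).
HB.instance Definition _ (R : realType) d := Measurable.on (Rn R d).

Section lebesgue_Rn.
Context {R : realType} (d : nat).
Local Notation mR := (measurableTypeR R).

Lemma open_measurable_Rn (A : set 'rV[R]_d) :
  open A -> measurable (A : set (Rn R d)).
Proof. exact: sub_sigma_algebra. Qed.

Lemma open_rat_balls (A : set 'rV[R]_d) : open A ->
  A = \bigcup_(qk in [set qk : 'rV[rat]_d * nat |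
                   ball (map_mx ratr qk.1 : 'rV[R]_d) qk.2.+1%:R^-1 `<=` A])
        ball (map_mx ratr qk.1 : 'rV[R]_d) qk.2.+1%:R^-1.
Proof.
move=> oA; apply/seteqP; split => [x Ax|x [qk /= + xq]]; last exact.
have /nbhs_ballP[e /= e0 eA] := open_nbhs_nbhs (conj oA Ax).
pose k := Num.truncn (e / 2)^-1.
have ke : k.+1%:R^-1 < e / 2.
  by rewrite invf_plt ?posrE ?divr_gt0 ?ltr0n// truncnS_gt.
have k0 : 0 < k.+1%:R^-1 :> R by rewrite invr_gt0 ltr0n.
have /choice[q qP] : forall i : 'I_d, exists q : rat,
    x ord0 i - k.+1%:R^-1 < ratr q < x ord0 i + k.+1%:R^-1.
  move=> i; have /rat_in_itvoo[q] :
    x ord0 i - k.+1%:R^-1 < x ord0 i + k.+1%:R^-1.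
    by rewrite ltrBlDr -addrA ltrDl addr_gt0.
  by rewrite in_itv; exists q.
have xq : ball (map_mx ratr (\row_i q i) : 'rV[R]_d) k.+1%:R^-1 x.
  split => // i j; rewrite (ord1 i) !mxE /ball /=.
  have /andP[q1 q2] := qP j.
  by rewrite ltr_distlC; apply/andP; split; rewrite 1?ltrBlDr// -ltrBlDr.
exists (\row_i q i, k) => //= y qy; apply: eA.
apply: (@le_ball _ _ x (k.+1%:R^-1 + k.+1%:R^-1)).
  by rewrite (le_trans (lerD (ltW ke) (ltW ke)))// -splitr.
exact: ball_triangle (ball_sym xq) qy.
Qed.

Definition tuple_row (t : d.-tuple mR) : Rn R d := \row_i tnth t i.

Lemma measurable_tuple_row : measurable_fun setT tuple_row.
Proof.
apply: (@measurability _ _ _ (Rn R d) setT tuple_row (@open 'rV[R]_d)) => //.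
move=> _ [A oA <-]; rewrite setTI (open_rat_balls oA) preimage_bigcup.
rewrite bigcup_mkcond; apply: countable_bigcupT_measurable; first exact: countableP.
move=> qk.
case: ifPn => // _.
have -> : tuple_row @^-1` ball (map_mx ratr qk.1 : 'rV[R]_d) qk.2.+1%:R^-1 =
  \bigcap_(i in [set: 'I_d]) ((fun t => tnth t i) @^-1`
     ball (ratr (qk.1 ord0 i) : R) qk.2.+1%:R^-1).
  apply/seteqP; split => t /=.
    by move=> [_ +] i _; move=> /(_ ord0 i); rewrite !mxE.
  move=> h; split => [|i j]; first by rewrite invr_gt0 ltr0n.
  by rewrite (ord1 i) !mxE; exact: h.
rewrite -[X in measurable X]setCK setC_bigcap; apply: measurableC.
apply: countable_bigcupT_measurable; first exact: countableP.
move=> i; apply: measurableC.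
rewrite -[X in measurable X]setTI; apply: measurable_tnth => //.
exact: measurable_ball.
Qed.

Definition lebesgue_Rn : set (Rn R d) -> \bar R :=
  pushforward (iterated_product (@lebesgue_measure R) d) tuple_row.

Let lebesgue_Rn0 : lebesgue_Rn set0 = 0%E.
Proof. by rewrite /lebesgue_Rn /pushforward preimage_set0 measure0. Qed.

Let lebesgue_Rn_ge0 A : (0 <= lebesgue_Rn A)%E.
Proof. by rewrite /lebesgue_Rn /pushforward; exact: measure_ge0. Qed.

Let lebesgue_Rn_sigma_additive : semi_sigma_additive lebesgue_Rn.
Proof.
move=> F mF tF mUF; rewrite /lebesgue_Rn /pushforward preimage_bigcup.
have mp A : measurable A -> measurable (tuple_row @^-1` A).
  by move=> mA; rewrite -[X in measurable X]setTI; exact: measurable_tuple_row.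
apply: measure_semi_sigma_additive.
- by move=> k; exact: mp.
- apply/trivIsetP => /= i j _ _ ij; rewrite -preimage_setI.
  by move/trivIsetP : tF => /(_ _ _ _ _ ij) ->//; rewrite preimage_set0.
- by rewrite -preimage_bigcup; exact: mp.
Qed.

HB.instance Definition _ := isMeasure.Build _ _ _ lebesgue_Rn
  lebesgue_Rn0 lebesgue_Rn_ge0 lebesgue_Rn_sigma_additive.

End lebesgue_Rn.

Lemma iterated_product_box d (T : measurableType d) (R : realType)
    (m1 : {sigma_finite_measure set T -> \bar R}) n (A : 'I_n -> set T) :
  (forall i, measurable (A i)) ->
  iterated_product m1 n [set t | forall i, A i (tnth t i)] =
  (\prod_(i < n) m1 (A i))%E.
Proof.
elim: n A => [|n ih] A mA.
  rewrite big_ord0 /= diracE mem_set//=; by case.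
have mB : measurable [set t : n.-tuple T | forall i, A (lift ord0 i) (tnth t i)].
  rewrite (_ : mkset _ = \bigcap_(i in [set: 'I_n])
    ((fun t => tnth t i) @^-1` A (lift ord0 i))); last first.
    by apply/seteqP; split => t /= h i; [move=> _|]; apply: h.
  rewrite -[X in measurable X]setCK setC_bigcap; apply: measurableC.
  apply: countable_bigcupT_measurable; first exact: countableP.
  move=> i; apply: measurableC.
  by rewrite -[X in measurable X]setTI; apply: measurable_tnth.
rewrite big_ord_recl -ih//= -product_measure1E//.
rewrite /product_step /pushforward; congr (product_measure1 _ _ _).
apply/seteqP; split => -[a t] /=.
  move=> h; split => /=; first by have := h ord0.
  by move=> i; have := h (lift ord0 i); rewrite /tuple_cons tnthS.
move=> [/= a0 h] i; case: (unliftP ord0 i) => [j|] ->; last by [].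
by rewrite /tuple_cons tnthS; apply: h.
Qed.

Lemma lebesgue_Rn_box (R : realType) n (A : 'I_n -> set R) :
  (forall i, measurable (A i)) ->
  lebesgue_Rn [set x : 'rV[R]_n | forall i, A i (x ord0 i)] =
  (\prod_(i < n) lebesgue_measure (A i))%E.
Proof.
move=> mA; rewrite -(iterated_product_box (@lebesgue_measure R))//.
rewrite /lebesgue_Rn /pushforward; congr (iterated_product _ _ _).
by apply/seteqP; split => t /= h i; have := h i; rewrite !mxE.
Qed.

(* The library's type {mfun_ mu, T >-> R} of classes of measurable functions
   modulo equality mu-a.e. carries no algebraic structure; it is given here the
   structure of a commutative ring and of an R-module. *)
Section ae_classes.
Context d (T : measurableType d) (R : realType).
Variable mu : {measure set T -> \bar R}.
Local Notation L0 := {mfun_ mu, T >-> R}.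
Local Open Scope quotient_scope.

Definition ae_class (f : {mfun T >-> R}) : L0 := \pi_L0 f.

Lemma ae_classP (f g : {mfun T >-> R}) :
  ae_class f = ae_class g <-> \forall x \ae mu, f x = g x.
Proof.
split=> [/eqmodP/asboolP fg|fg].
  by apply: filterS fg => x; apply.
by apply/eqmodP/asboolP; apply: filterS fg.
Qed.

Lemma ae_class_repr (f : L0) : ae_class (repr f) = f.
Proof. exact: reprK. Qed.

Lemma repr_ae_class (f : {mfun T >-> R}) :
  \forall x \ae mu, (ae_class f : T -> R) x = f x.
Proof. by apply/ae_classP; exact: ae_class_repr. Qed.

Lemma ae_class_ind (P : L0 -> Prop) :
  (forall f, P (ae_class f)) -> forall f, P f.
Proof. by move=> h f; rewrite -(ae_class_repr f). Qed.

Definition L0_zero : L0 := ae_class 0.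
Definition L0_one : L0 := ae_class 1.
Definition L0_opp (f : L0) : L0 := ae_class (- repr f).
Definition L0_add (f g : L0) : L0 := ae_class (repr f + repr g).
Definition L0_mul (f g : L0) : L0 := ae_class (repr f * repr g).
Definition L0_scale (a : R) (f : L0) : L0 := ae_class (a *: repr f).

Let oppE f : L0_opp (ae_class f) = ae_class (- f).
Proof.
by apply/ae_classP; apply: filterS (repr_ae_class f) => x /= fx; congr (- _).
Qed.

Let addE f g : L0_add (ae_class f) (ae_class g) = ae_class (f + g).
Proof.
apply/ae_classP; apply: filterS2 (repr_ae_class f) (repr_ae_class g) => x /=.
by move=> fx gx; congr (_ + _).
Qed.

Let mulE f g : L0_mul (ae_class f) (ae_class g) = ae_class (f * g).
Proof.
apply/ae_classP; apply: filterS2 (repr_ae_class f) (repr_ae_class g) => x /=.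
by move=> fx gx; congr (_ * _).
Qed.

Let scaleE a f : L0_scale a (ae_class f) = ae_class (a *: f).
Proof.
by apply/ae_classP; apply: filterS (repr_ae_class f) => x /= fx; congr (_ * _).
Qed.

Let addA : associative L0_add.
Proof.
elim/ae_class_ind => f; elim/ae_class_ind => g; elim/ae_class_ind => h.
by rewrite !addE addrA.
Qed.

Let addC : commutative L0_add.
Proof.
by elim/ae_class_ind => f; elim/ae_class_ind => g; rewrite !addE addrC.
Qed.

Let add0 : left_id L0_zero L0_add.
Proof. by elim/ae_class_ind => f; rewrite addE add0r. Qed.

Let addN : left_inverse L0_zero L0_opp L0_add.
Proof. by elim/ae_class_ind => f; rewrite oppE addE addNr. Qed.

HB.instance Definition _ := GRing.isZmodule.Build L0 addA addC add0 addN.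

Let mulA : associative L0_mul.
Proof.
elim/ae_class_ind => f; elim/ae_class_ind => g; elim/ae_class_ind => h.
by rewrite !mulE mulrA.
Qed.

Let mulC : commutative L0_mul.
Proof.
by elim/ae_class_ind => f; elim/ae_class_ind => g; rewrite !mulE mulrC.
Qed.

Let mul1 : left_id L0_one L0_mul.
Proof. by elim/ae_class_ind => f; rewrite mulE mul1r. Qed.

Let mulDl : left_distributive L0_mul +%R.
Proof.
elim/ae_class_ind => f; elim/ae_class_ind => g; elim/ae_class_ind => h.
rewrite [in LHS]/GRing.add/= [in RHS]/GRing.add/= addE !mulE addE.
by rewrite mulrDl.
Qed.

HB.instance Definition _ :=
  GRing.Zmodule_isComPzRing.Build L0 mulA mulC mul1 mulDl.

Let scaleA a b f : L0_scale a (L0_scale b f) = L0_scale (a * b) f.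
Proof. by elim/ae_class_ind: f => f; rewrite !scaleE scalerA. Qed.

Let scale1 : left_id 1 L0_scale.
Proof. by elim/ae_class_ind => f; rewrite scaleE scale1r. Qed.

Let scaleDr : right_distributive L0_scale +%R.
Proof.
move=> a; elim/ae_class_ind => f; elim/ae_class_ind => g.
rewrite [in LHS]/GRing.add/= [in RHS]/GRing.add/= addE !scaleE addE.
by rewrite scalerDr.
Qed.

Let scaleDl f : {morph L0_scale^~ f : a b / a + b}.
Proof.
move=> a b; elim/ae_class_ind: f => f.
rewrite [in RHS]/GRing.add/= !scaleE addE.
by rewrite scalerDl.
Qed.

HB.instance Definition _ :=
  GRing.Zmodule_isLmodule.Build R L0 scaleA scale1 scaleDr scaleDl.

Lemma L0_addE (f g : L0) :
  \forall x \ae mu, (f + g : L0) x = f x + g x.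
Proof. exact: (repr_ae_class (repr f + repr g)). Qed.

Lemma L0_mulE (f g : L0) :
  \forall x \ae mu, (f * g : L0) x = f x * g x.
Proof. exact: (repr_ae_class (repr f * repr g)). Qed.

Lemma L0_scaleE a (f : L0) :
  \forall x \ae mu, (a *: f : L0) x = a * f x.
Proof. exact: (repr_ae_class (a *: repr f)). Qed.

End ae_classes.

Section Lp_spaces.
Context d (T : measurableType d) (R : realType).
Variable mu : {measure set T -> \bar R}.
Local Notation L0 := {mfun_ mu, T >-> R}.
Implicit Types (f g v : L0) (S V : set L0) (p : \bar R).

Definition Lp p : set L0 := [set f | finite_norm mu p f].

Definition Lp_norm p f : R := fine ('N[mu]_p[EFin \o f])%E.

Definition ae_le f g := \forall x \ae mu, f x <= g x.

Definition closed_in_Lp p S :=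
  forall f, Lp p f ->
    (forall e, 0 < e -> exists2 g, S g & Lp_norm p (f - g) < e) -> S f.

Definition bounded_in_Lp p S :=
  exists C, forall f, S f -> Lp_norm p f <= C.

(* Closedness for the weak-* topology of L^oo as the dual of L^1: the sets
   {h | |\int (f - h) g_i| < e for all i}, for finitely many g_i in L^1, are the
   basic neighbourhoods of f. *)
Definition weak_star_closed S :=
  forall f, Lp +oo f ->
    (forall n (g : 'I_n -> L0) e, (forall i, Lp 1 (g i)) -> 0 < e ->
       exists2 h, S h & forall i, `|\int[mu]_x (((f - h) * g i : L0) x)| < e) ->
    S f.

Definition in_finite_dim_L2 V :=
  exists n (e : 'I_n -> L0), (forall i, Lp 2%:E (e i)) /\
    forall v, V v -> exists c : 'I_n -> R, v = \sum_i c i *: e i.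

(* A map selecting a nearest point of S for every element of L^2; in particular
   a nearest point always exists. *)
Definition metric_projection S (P : L0 -> L0) :=
  forall v, Lp 2%:E v ->
    S (P v) /\ forall s, S s -> Lp_norm 2%:E (v - P v) <= Lp_norm 2%:E (v - s).

Definition mcc_le0 (ul uu wl wu u w z : L0) :=
  \forall x \ae mu,
    [/\ ul x * w x + u x * wl x - ul x * wl x - z x <= 0,
        uu x * w x + u x * wu x - uu x * wu x - z x <= 0,
        z x - uu x * w x - u x * wl x + uu x * wl x <= 0 &
        z x - ul x * w x - u x * wu x + ul x * wu x <= 0].

Definition bounded_L2_operator (Y : normedModType R) (O : L0 -> Y) :=
  (forall a f g, Lp 2%:E f -> Lp 2%:E g -> O (a *: f + g) = a *: O f + O g) /\
  (exists C, forall f, Lp 2%:E f -> `|O f| <= C * Lp_norm 2%:E f).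

End Lp_spaces.

Section optimization.
Context {R : realType} {E : lmodType R}.

Definition convex_hull (S : set E) : set E :=
  [set x | exists n (l : 'I_n -> R) (s : 'I_n -> E),
    [/\ forall i, 0 <= l i, \sum_i l i = 1, forall i, S (s i) &
        x = \sum_i l i *: s i]].

Definition convex_minimization_problem (J : E -> R) (F : set E) :=
  convex_set F /\ convex_function F J.

Definition minimizer (J : E -> R) (F : set E) (x : E) :=
  F x /\ forall y, F y -> J x <= J y.

End optimization.

Section dual_space.
Context {R : realType} {U : normedModType R}.

Definition dual : set (U -> R^o) := [set f | linear f /\ continuous f].

Definition dual_norm (f : U -> R^o) : R :=
  sup [set `|f x| | x in [set x : U | `|x| <= 1]].

Definition is_reflexive :=
  forall Phi : (U -> R^o) -> R,
    (forall a f g, dual f -> dual g -> Phi (a *: f + g) = a * Phi f + Phi g) ->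
    (exists C, forall f, dual f -> `|Phi f| <= C * dual_norm f) ->
    exists u : U, forall f, dual f -> Phi f = f u.

Definition dual_isomorphism (A : {linear U -> (U -> R^o)}) :=
  [/\ forall u, dual (A u),
      forall phi, dual phi -> exists! u, A u = phi,
      exists C, forall u, dual_norm (A u) <= C * `|u| &
      exists C, forall u, `|u| <= C * dual_norm (A u)].

End dual_space.
Arguments is_reflexive {R} U.

Section state_equation.
Context d (T : measurableType d) (R : realType).
Variable mu : {measure set T -> \bar R}.
Local Notation L0 := {mfun_ mu, T >-> R}.
Variables (U : normedModType R) (iota : {linear U -> L0}).

Definition continuous_embedding (p : \bar R) :=
  injective iota /\
  exists C, forall u, Lp p (iota u) /\ Lp_norm p (iota u) <= C * `|u|.

(* A u + f0 z = f1 in U^*: the function f0 z acts on U by v |-> \int f0 z v,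
   and these integrals are required to exist. *)
Definition state_eq (A : {linear U -> (U -> R^o)}) (f0 : L0) (f1 : U -> R^o)
    (u : U) (z : L0) :=
  (forall v, mu.-integrable setT (EFin \o (f0 * z * iota v : L0))) /\
  A u + (fun v => \int[mu]_x ((f0 * z * iota v : L0) x)) = f1.

End state_equation.

Section domains.
Context {R : realType}.

Definition enorm n (x : 'rV[R]_n) : R := Num.sqrt (\sum_i x ord0 i ^+ 2).

(* Near each boundary point, in some orthonormal coordinates, the set is the
   region strictly above the graph of a Lipschitz function of the first n
   coordinates. *)
Definition lipschitz_boundary n (D : set 'rV[R]_n.+1) :=
  forall x0, (closure D `\` D°) x0 ->
    exists (Q : 'M[R]_n.+1) (gamma : 'rV[R]_n -> R) (r L : R),
      [/\ Q *m Q^T = 1%:M, 0 < r,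
          forall a b, `|gamma a - gamma b| <= L * enorm (a - b) &
          forall x, enorm (x - x0) < r ->
            (D x <-> gamma (col' ord_max (x *m Q)) < (x *m Q) ord0 ord_max)].

Record lipschitz_domain n := LipschitzDomain {
  dom_set :> set 'rV[R]_n.+1 ;
  dom_open : open dom_set ;
  dom_nonempty : dom_set !=set0 ;
  dom_connected : connected dom_set ;
  dom_bounded : bounded_set dom_set ;
  dom_lipschitz : lipschitz_boundary dom_set }.
Arguments dom_open {n} _.

Definition dom_measure n (Omega : lipschitz_domain n) :
    {measure set (Rn R n.+1) -> \bar R} :=
  mrestr (@lebesgue_Rn R n.+1) (open_measurable_Rn (dom_open Omega)).

Record mesh n (Omega : lipschitz_domain n) := Mesh {
  mesh_card : nat ;
  mesh_cell : 'I_mesh_card -> set 'rV[R]_n.+1 ;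
  mesh_partition : partition setT mesh_cell (dom_set Omega) ;
  mesh_measurable : forall i, measurable (mesh_cell i : set (Rn R n.+1)) ;
  mesh_cell_gt0 : forall i, (0 < dom_measure Omega (mesh_cell i))%E }.
Arguments mesh_cell {n Omega} _ _.
Arguments mesh_measurable {n Omega} _ _.

Section mesh_theory.
Context n (Omega : lipschitz_domain n).
Local Notation mu := (dom_measure Omega).
Local Notation L0 := {mfun_ mu, Rn R n.+1 >-> R}.
Variable Q : mesh Omega.

Definition mesh_size : R :=
  sup [set r | exists i x y,
    [/\ mesh_cell Q i x, mesh_cell Q i y & r = enorm (x - y)]].

Definition local_average (v : L0) : L0 :=
  \sum_i ((fine (mu (mesh_cell Q i)))^-1 * \int[mu]_(x in mesh_cell Q i) v x)
           *: ae_class mu (indic_mfun _ (mesh_measurable Q i)).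

Definition cell_bounds (l u : 'I_(mesh_card Q) -> R) (v : L0) :=
  forall i, \forall x \ae mu, mesh_cell Q i x -> l i <= v x <= u i.

Definition piecewise_constant (v : L0) :=
  exists c : 'I_(mesh_card Q) -> R,
    forall i, \forall x \ae mu, mesh_cell Q i x -> v x = c i.

End mesh_theory.
End domains.
Arguments lipschitz_domain R n : clear implicits.

(* Classes of measurable functions modulo equality a.e. in Omega. *)
Notation L0 R Omega := {mfun_ (dom_measure Omega), Rn R _ >-> R}.

Section problems.
Context (R : realType) (n : nat) (Omega : lipschitz_domain R n).
Local Notation L0 := (L0 R Omega).
Variables (U Y : normedModType R) (iota : {linear U -> L0}).
Variables (A : {linear U -> (U -> R^o)}) (f0 : L0) (f1 : U -> R^o).

Definition solves_E (u : U) (w : L0) := state_eq iota A f0 f1 u (iota u * w).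

Definition solves_E_tau (Q : mesh Omega) (u : U) (w : L0) :=
  state_eq iota A f0 f1 u (local_average Q (iota u) * local_average Q w).

Definition feasible_I (Wh : set L0) : set (U * L0) :=
  [set x | solves_E x.1 x.2 /\ Wh x.2].

Definition feasible_McC (ul uu wl wu : L0) (Wh Z : set L0) : set (U * L0 * L0) :=
  [set x | let: (u, w, z) := x in
    [/\ state_eq iota A f0 f1 u z, mcc_le0 ul uu wl wu (iota u) w z,
        convex_hull Wh w & Z z]].

Definition objective_I (O : L0 -> Y) (y : Y) (x : U * L0) : R :=
  `|O (iota x.1) - y|.

Definition objective_McC (O : L0 -> Y) (y : Y) (x : U * L0 * L0) : R :=
  `|O (iota x.1.1) - y|.

End problems.

(* Main.v *)
Require Import Defs.
From mathcomp Require Import all_boot all_order all_algebra.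
From mathcomp Require Import all_classical all_reals all_analysis.
From mathcomp Require Import measurable_realfun ess_sup_inf zify ring lra.

Set Implicit Arguments.
Unset Strict Implicit.
Unset Printing Implicit Defensive.

Import Order.TTheory GRing.Theory Num.Theory.
Import numFieldNormedType.Exports.

Local Open Scope classical_set_scope.
Local Open Scope ring_scope.

(* The direct method works here with strong convergence.  On the feasible set
   the functional Phi(u, w, z) = int w^2 + z^2 is bounded and uniformly convex,
   so a minimizing sequence whose members almost minimize Phi among the
   almost optimal points is Cauchy in (w, z), by the parallelogram identity; a
   subsequence converges a.e., within the uniform bounds on w and z.  Dominated
   convergence turns this into weak-* convergence of z, hence the limit stays
   in Zad, and into convergence of f0 z in the dual of U, hence u, which is
   A^-1 (f1 - f0 z), converges in norm.  The limit of w stays in the convex hull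
   of the control set because that set is, in coordinates, a compact subset of
   a finite-dimensional space, whose hull is compact by Caratheodory. *)

(** * Minimizing sequences *)

(** The objective sees only [u], so an arbitrary minimizing sequence may oscillate in [w] and [z];
    Phi is there to select among almost optimal points. It leaves out [u] because [u] is determined
    by [z]. Squared distances are driven below a multiple of 4^-k so that, on a domain of finite
    measure, the L1 distances of consecutive members are of order 2^-k; these are summable, which
    gives convergence a.e. Dominated convergence in L^q, with q conjugate to p, needs q finite,
    hence p > 1; the case p = 1 is moved to another exponent. Closedness of the control set comes
    from its metric projection: a set in which every L2 function has a nearest point contains its L2
    limit points. The same projection provides a control to start from, whose state and product form
    a feasible triple. *)

Lemma convex_setP (R : realType) (E : lmodType R) (F : set E) :
  convex_set F <-> forall x y (t : R), F x -> F y -> 0 <= t <= 1 ->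
    F (t *: x + (1 - t) *: y).
Proof.
split=> [cF x y t Fx Fy /andP[t0 t1]|cF x y t].
  have := cF x y (Itv01 t0 t1); rewrite !inE; exact.
rewrite !inE => Fx Fy; apply: cF => //.
by rewrite ge0 le1.
Qed.

Lemma convex_functionP (R : realType) (E : lmodType R) (F : set E) (J : E -> R) :
  convex_function F J <-> forall x y (t : R), F x -> F y -> 0 <= t <= 1 ->
    J (t *: x + (1 - t) *: y) <= t * J x + (1 - t) * J y.
Proof.
split=> [cF x y t Fx Fy /andP[t0 t1]|cF t x y].
  have := cF (Itv01 t0 t1) x y; rewrite !inE; exact.
rewrite !inE => Fx Fy; apply: cF => //.
by rewrite ge0 le1.
Qed.

Lemma approximate_minimizer (R : realType) (E : Type) (F : set E) (J : E -> R)
    (b e : R) :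
  F !=set0 -> (forall x, F x -> b <= J x) -> 0 < e ->
  exists2 x, F x & forall y, F y -> J x <= J y + e.
Proof.
move=> [x0 Fx0] Jb e0; have hi : has_inf (J @` F).
  by split; [exists (J x0), x0|exists b => _ [x Fx <-]; exact: Jb].
have [_ [x Fx <-] xe] := inf_adherent e0 hi; exists x => // y Fy.
by rewrite (le_trans (ltW xe))// lerD2r; apply: ge_inf; [case: hi|exists y].
Qed.

(* Among the points that are optimal up to 2^-j, let r_j be the infimum of Phi;
   r_j is nondecreasing and bounded, and the midpoint of two nearly Phi-minimal
   points cannot lower Phi by much, so these points are close to each other. *)
Lemma minimizing_sequence (R : realType) (E : lmodType R) (F : set E)
    (J Phi : E -> R) (D : E -> E -> R) (B : R) :
  F !=set0 -> convex_set F -> convex_function F J ->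
  (forall x, F x -> 0 <= J x) -> (forall x, F x -> 0 <= Phi x <= B) ->
  (forall x y, F x -> F y ->
    Phi (2^-1 *: x + (1 - 2^-1) *: y) <= (Phi x + Phi y) / 2 - D x y) ->
  exists x : nat -> E, forall k,
    [/\ F (x k), forall y, F y -> J (x k) <= J y + 2^-k &
        D (x k) (x k.+1) <= 2^-k ^+ 2].
Proof.
move=> F0 /convex_setP cF /convex_functionP cJ J0 PhiB mid.
have h01 : 0 <= (2^-1 : R) <= 1 by apply/andP; split; lra.
have p2 (k : nat) : 0 < 2^-k :> R by rewrite invr_gt0 exprn_gt0.
pose C j := [set x | F x /\ forall y, F y -> J x <= J y + 2^-j].
have C0 j : C j !=set0.
  by have [x Fx xP] := approximate_minimizer F0 J0 (p2 j); exists x.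
have lC i j : (i <= j)%N -> C j `<=` C i.
  move=> ij x [Fx xj]; split => // y Fy.
  rewrite (le_trans (xj y Fy))// lerD2l lef_pV2 ?posrE ?exprn_gt0//.
  by rewrite ler_weXn2l// ler1n.
have midC j x y : C j x -> C j y -> C j (2^-1 *: x + (1 - 2^-1) *: y).
  move=> [Fx xj] [Fy yj]; split; first exact: cF.
  move=> z Fz; rewrite (le_trans (cJ _ _ _ Fx Fy h01))//.
  by have := xj z Fz; have := yj z Fz; lra.
pose r j := inf (Phi @` C j).
have hir j : has_inf (Phi @` C j).
  have [x Cx] := C0 j; split; first by exists (Phi x), x.
  by exists 0 => _ [y [Fy _] <-]; have /andP[] := PhiB y Fy.
have rle j x : C j x -> r j <= Phi x.
  by move=> Cx; apply: ge_inf; [by case: (hir j)|exists x].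
have rm i j : (i <= j)%N -> r i <= r j.
  move=> ij; have [x Cx] := C0 j.
  apply: lb_le_inf; first by exists (Phi x), x.
  by move=> _ [y Cy <-]; apply: rle; exact: lC Cy.
have hsr : has_sup (range r).
  split; first by exists (r 0%N), 0%N.
  exists B => _ [j _ <-]; have [x Cx] := C0 j; apply: le_trans (rle _ _ Cx) _.
  by case: Cx => Fx _; case/andP: (PhiB x Fx).
(* The tolerance is squared because [D] is a squared distance. With r_i close to the supremum and j
   = max(k, i), a nearly Phi-minimal point of C_j exceeds the supremum by at most the tolerance. *)
have /choice[x xP] : forall k, exists x, exists j,
    [/\ (k <= j)%N, C j x, sup (range r) - 2^-k ^+ 2 / 2 <= r j &
        Phi x <= sup (range r) + 2^-k ^+ 2 / 2].
  move=> k; have e0 : 0 < 2^-k ^+ 2 / 2 :> R by rewrite divr_gt0// exprn_gt0.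
  have [_ [i _ <-] ri] := sup_adherent e0 hsr.
  have [_ [x Cx <-] xr] := inf_adherent e0 (hir (maxn k i)).
  have := rm i _ (leq_maxr k i) => rki.
  have : r (maxn k i) <= sup (range r).
    by apply: ub_le_sup; [by case: hsr|exists (maxn k i)].
  rewrite -/(r _) in xr => rs.
  exists x, (maxn k i); split => //; first exact: leq_maxl.
    by rewrite (le_trans (ltW ri)).
  by rewrite (le_trans (ltW xr))// lerD2r.
exists x => k; have [j [kj Cj rj Pj]] := xP k; have [i [ki Ci ri Pi]] := xP k.+1.
have [Fx xk] := lC _ _ kj _ Cj; have [Fy _] := Ci; split => //.
(* Both points lie in C_min(i,j), hence so does their midpoint. With e = 4^-k and s the supremum,
   [D] is at most (s + e/2 + s + e/8)/2 - (s - e/2) = 13e/16. *)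
have := rle _ _ (midC (minn i j) _ _ (lC _ _ (geq_minr i j) _ Cj)
                                  (lC _ _ (geq_minl i j) _ Ci)).
have := mid _ _ Fx Fy.
have qk : 2^-(k.+1) ^+ 2 = 2^-k ^+ 2 / 4 :> R.
  by rewrite -[X in X ^+ 2]exprVn [X in X ^+ 2]exprS exprVn exprMn; lra.
have q0 : 0 <= 2^-k ^+ 2 :> R by rewrite exprn_ge0// ltW.
have : sup (range r) - 2^-k ^+ 2 / 2 <= r (minn i j).
  by rewrite /minn; case: ifP => _ //; lra.
by lra.
Qed.
(** * Convex hulls in finite dimension *)

Lemma convex_hull_sub (R : realType) (E : lmodType R) (S : set E) :
  S `<=` convex_hull S.
Proof.
move=> x Sx; exists 1%N, (fun=> 1), (fun=> x); split => //.
  by rewrite big_ord1.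
by rewrite big_ord1 scale1r.
Qed.

Lemma convex_convex_hull (R : realType) (E : lmodType R) (S : set E) :
  convex_set (convex_hull S).
Proof.
apply/convex_setP => x y t [n [l [s [l0 l1 Ss ->]]]].
move=> [m [k [r [k0 k1 Sr ->]]]] /andP[t0 t1].
pose L (i : 'I_(n + m)) :=
  match fintype.split i with inl j => t * l j | inr j => (1 - t) * k j end.
pose V (i : 'I_(n + m)) :=
  match fintype.split i with inl j => s j | inr j => r j end.
have Ll j : L (lshift m j) = t * l j by rewrite /L (unsplitK (inl j)).
have Lr j : L (rshift n j) = (1 - t) * k j by rewrite /L (unsplitK (inr j)).
have Vl j : V (lshift m j) = s j by rewrite /V (unsplitK (inl j)).
have Vr j : V (rshift n j) = r j by rewrite /V (unsplitK (inr j)).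
exists (n + m)%N, L, V; split.
- by move=> i; rewrite /L; case: fintype.split => j; rewrite mulr_ge0// subr_ge0.
- rewrite big_split_ord/=.
  rewrite (eq_bigr _ (fun j _ => Ll j)) (eq_bigr _ (fun j _ => Lr j)).
  by rewrite -!mulr_sumr l1 k1 !mulr1 subrKC.
- by move=> i; rewrite /V; case: fintype.split.
- rewrite big_split_ord/= !scaler_sumr; congr (_ + _); apply: eq_bigr => j _.
    by rewrite Ll Vl scalerA.
  by rewrite Lr Vr scalerA.
Qed.

Lemma convex_hull_image (R : realType) (E F : lmodType R) (phi : E -> F)
    (K : set E) : linear phi ->
  convex_hull (phi @` K) = phi @` convex_hull K.
Proof.
move=> lphi; have phi_sum n (l : 'I_n -> R) (s : 'I_n -> E) :
    phi (\sum_i l i *: s i) = \sum_i l i *: phi (s i).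
  have phi0 : phi 0 = 0.
    by have := lphi (-1) 0 0; rewrite scaler0 addr0 scaleN1r addNr.
  elim: n l s => [|n ih] l s; first by rewrite !big_ord0.
  by rewrite !big_ord_recl lphi ih.
apply/seteqP; split => [_ [n [l [s [l0 l1 Ks ->]]]]|].
  have /choice[t tP] : forall i, exists t, K t /\ phi t = s i.
    by move=> i; have [t Kt ts] := Ks i; exists t.
  exists (\sum_i l i *: t i).
    by exists n, l, t; split => // i; case: (tP i).
  by rewrite phi_sum; apply: eq_bigr => i _; case: (tP i) => _ ->.
move=> _ [_ [n [l [s [l0 l1 Ks ->]]]] <-].
exists n, l, (phi \o s); split => // i.
by exists (s i).
Qed.

(** More than m + 1 points of an m-dimensional space are affinely dependent; sliding the weights
    along a dependence until one of them vanishes drops a point. *)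
Lemma caratheodory_step (R : realType) m k (S : set 'rV[R]_m)
    (l : 'I_k.+1 -> R) (s : 'I_k.+1 -> 'rV[R]_m) :
  (m.+1 <= k)%N -> (forall i, 0 <= l i) -> \sum_i l i = 1 ->
  (forall i, S (s i)) ->
  exists l' : 'I_k -> R, exists s' : 'I_k -> 'rV[R]_m,
    [/\ forall i, 0 <= l' i, \sum_i l' i = 1, forall i, S (s' i) &
        \sum_i l' i *: s' i = \sum_i l i *: s i].
Proof.
move=> mk l0 l1 Ss.
(* The appended column of ones makes a vector of the left kernel an affine dependence: its entries
   sum to zero as well. *)
pose M : 'M[R]_(k.+1, m + 1) :=
  row_mx (\matrix_(i, j) s i ord0 j) (const_mx 1).
have : kermx M != 0.
  rewrite kermx_eq0 -row_leq_rank -ltnNge (leq_ltn_trans (rank_leq_col M))//.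
  by rewrite addn1.
move=> /rowV0Pn[u /sub_kermxP uM u0].
move: uM; rewrite mul_mx_row -[RHS]row_mx0 => /eq_row_mx[us u1].
have {us}us : \sum_i u ord0 i *: s i = 0.
  apply/rowP => j; rewrite -[in RHS]us summxE !mxE.
  by apply: eq_bigr => i _; rewrite !mxE.
have {u1}u1 : \sum_i u ord0 i = 0.
  move/rowP: u1 => /(_ ord0); rewrite !mxE => u1; rewrite -[RHS]u1.
  by apply: eq_bigr => i _; rewrite !mxE mulr1.
have [i0 ui0] : exists i, 0 < u ord0 i.
  apply: contrapT => /forallNP un; case/eqP: u0; apply/rowP => i; rewrite mxE.
  have un0 j : true -> 0 <= - u ord0 j.
    by move=> _; rewrite oppr_ge0 leNgt; apply/negP/un.
  have /psumr_eq0P : \sum_j - u ord0 j = 0 by rewrite sumrN u1 oppr0.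
  by move=> /(_ un0 i isT)/eqP; rewrite oppr_eq0 => /eqP.
(* The least ratio is the largest multiple of [u] that can be subtracted while all weights stay
   nonnegative; weight [j] becomes zero. *)
have [j uj jmin] := @arg_minP _ _ _ i0 (fun i => 0 < u ord0 i)
  (fun i => l i / u ord0 i) ui0.
pose t := l j / u ord0 j; pose l' i := l i - t * u ord0 i.
have t0 : 0 <= t by rewrite divr_ge0// ltW.
have l'j : l' j = 0 by rewrite /l' /t divfK ?subrr// gt_eqF.
have l'0 i : 0 <= l' i.
  rewrite subr_ge0; have [ui|ui] := ltP 0 (u ord0 i).
    by rewrite -ler_pdivlMr//; exact: jmin.
  by rewrite (le_trans _ (l0 i))// mulr_ge0_le0.
exists (l' \o lift j), (s \o lift j); split => //=.
- transitivity (\sum_i l' i); first by rewrite (bigD1_ord j)//= l'j add0r.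
  by rewrite sumrB l1 -mulr_sumr u1 mulr0 subr0.
- transitivity (\sum_i l' i *: s i).
    by rewrite [RHS](bigD1_ord j)//= l'j scale0r add0r.
  transitivity (\sum_i (l i *: s i - t *: (u ord0 i *: s i))).
    by apply: eq_bigr => i _; rewrite scalerA -scalerBl.
  by rewrite sumrB -scaler_sumr us scaler0 subr0.
Qed.

(** The number of points is exactly m + 1, reached by padding with zero weights if needed, so that a
    single product space parametrizes the whole hull. *)
Lemma caratheodory (R : realType) m (S : set 'rV[R]_m) (x : 'rV[R]_m) :
  convex_hull S x ->
  exists l : 'I_m.+1 -> R, exists s : 'I_m.+1 -> 'rV[R]_m,
    [/\ forall i, 0 <= l i, \sum_i l i = 1, forall i, S (s i) &
        x = \sum_i l i *: s i].
Proof.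
have extend k (l : 'I_k.+1 -> R) (s : 'I_k.+1 -> 'rV[R]_m) :
    (forall i, 0 <= l i) -> \sum_i l i = 1 -> (forall i, S (s i)) ->
    exists l' : 'I_k.+2 -> R, exists s' : 'I_k.+2 -> 'rV[R]_m,
    [/\ forall i, 0 <= l' i, \sum_i l' i = 1, forall i, S (s' i) &
        \sum_i l' i *: s' i = \sum_i l i *: s i].
  move=> l0 l1 Ss; exists (fun i => oapp l 0 (unlift ord0 i)).
  exists (fun i => oapp s (s ord0) (unlift ord0 i)); split.
  - by move=> i; case: unliftP => /=.
  - rewrite big_ord_recl unlift_none/= add0r -l1.
    by apply: eq_bigr => i _; rewrite liftK.
  - by move=> i; case: unliftP => /=.
  - rewrite big_ord_recl unlift_none/= scale0r add0r.
    by apply: eq_bigr => i _; rewrite liftK.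
move=> [n [l [s [l0 l1 Ss ->]]]].
case: n l s l0 l1 Ss => [|n] l s l0 l1 Ss.
  by move: l1; rewrite big_ord0 => /esym/eqP; rewrite oner_eq0.
(* With truncated subtraction this is the distance between n and m, which a padding or a reduction
   decreases by one. *)
have [d] := ubnP ((n - m) + (m - n)); elim: d n l s l0 l1 Ss => // d ih.
move=> n l s l0 l1 Ss; rewrite ltnS => nd.
have [nm|mn|nm] := ltngtP n m; last first.
- by subst n; exists l, s.
- case: n mn nd l s l0 l1 Ss => // n mn nd l s l0 l1 Ss.
  have [l' [s' [l'0 l'1 Ss' <-]]] := caratheodory_step mn l0 l1 Ss.
  by apply: (ih n l' s') => //; lia.
- have [l' [s' [l'0 l'1 Ss' <-]]] := extend n l s l0 l1 Ss.
  by apply: (ih n.+1 l' s') => //; lia.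
Qed.

(** The weights and points of Caratheodory's theorem range over a closed part of a product of
    compact sets, and the convex combination depends continuously on them. *)
Lemma compact_convex_hull (R : realType) m (K : set 'rV[R]_m) :
  compact K -> compact (convex_hull K).
Proof.
move=> cK; pose P := prod_topology (fun _ : 'I_m.+1 => (R * 'rV[R]_m)%type).
pose S : set P := [set f | forall i, (`[0, 1]%classic `*` K) (f i)].
have cS : compact S.
  apply: (@tychonoff _ (fun=> (R * 'rV[R]_m)%type) (fun=> `[0, 1] `*` K)) => i.
  by apply: compact_setX => //; exact: segment_compact.
have pc i : continuous (fun f : P => f i).
  exact: (@proj_continuous _ (fun=> (R * 'rV[R]_m)%type) i).
have pl i : continuous (fun f : P => (f i).1).
  by move=> f; apply: continuous_comp; [exact: pc|exact: cvg_fst].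
have ps i : continuous (fun f : P => (f i).2).
  by move=> f; apply: continuous_comp; [exact: pc|exact: cvg_snd].
pose D : set P := (fun f : P => \sum_i (f i).1) @^-1` [set 1].
have cD : closed D.
  apply: preimage_closed; last exact: closed_eq.
  have cs : continuous (fun f : P => \sum_i (f i).1).
    by apply: continuous_big => [|i _]; [exact: add_continuous|exact: pl].
  by move=> f _; exact: cs.
pose phi (f : P) : 'rV[R]_m := \sum_i (f i).1 *: (f i).2.
have -> : convex_hull K = phi @` (S `&` D).
  apply/seteqP; split=> [x /caratheodory[l [s [l0 l1 Ks ->]]]|_ [f [Sf Df] <-]].
    exists (fun i => (l i, s i)) => //; split => // i /=; split => //=.
    rewrite in_itv/= l0 -l1 (bigD1 i)//= lerDl sumr_ge0//.
  exists m.+1, (fun i => (f i).1), (fun i => (f i).2); split => // i.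
    by have [/=] := Sf i; rewrite in_itv/= => /andP[].
  by have [] := Sf i.
apply: continuous_compact; last exact: compact_closedI.
apply: continuous_subspaceT; apply: continuous_big => [|i _].
  exact: add_continuous.
move=> f; have FF : Filter (nbhs f) by exact: nbhs_filter.
exact: (@cvgZ _ _ _ _ FF _ _ _ _ (pl i f) (ps i f)).
Qed.
(** * Almost everywhere convergence and integration *)

Section ae_convergence.
Context d (T : measurableType d) (R : realType).
Variable mu : {measure set T -> \bar R}.

(** By monotone convergence the sum of the |g k| has integral at most 2C; it is therefore finite
    a.e., and there the series converges absolutely. *)
Lemma ae_cvg_series (g : nat -> T -> R) (C : R) :
  (forall k, measurable_fun setT (g k)) ->
  (forall k, \int[mu]_x `|g k x|%:E <= (C * 2^-k)%:E)%E ->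
  \forall x \ae mu, cvgn (series (g ^~ x)).
Proof.
move=> mg gC; pose G k x : \bar R := `|g k x|%:E.
have mG k : measurable_fun setT (G k).
  by apply/measurable_EFinP; exact: measurableT_comp.
have G0 k x : (0 <= G k x)%E by rewrite lee_fin.
have mS : measurable_fun setT (fun x => \sum_(0 <= k <oo) G k x)%E.
  by apply: ge0_emeasurable_sum => // k x _ _; exact: G0.
have C0 : 0 <= C.
  have := gC 0%N; rewrite expr0 invr1 mulr1 -lee_fin; apply: le_trans.
  exact: integral_ge0.
have iS : mu.-integrable setT (fun x => \sum_(0 <= k <oo) G k x)%E.
  apply/integrableP; split => //.
  under eq_integral do rewrite gee0_abs ?nneseries_ge0//.
  rewrite integral_nneseries//.
  apply: (@le_lt_trans _ _ (2 * C)%:E); last exact: ltry.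
  apply: lime_le; first by apply: is_cvg_nneseries => k _ _; exact: integral_ge0.
  apply: nearW => n; apply: (@le_trans _ _ (\sum_(0 <= k < n) C * 2^-k)%:E).
    by rewrite -sumEFin; apply: lee_sum => k _; exact: gC.
  rewrite lee_fin -mulr_sumr mulrC ler_wpM2r//.
  have -> : \sum_(0 <= k < n) 2^-k = 2 - 2 * 2^-n :> R.
    elim: n => [|n ih]; first by rewrite big_geq// expr0 invr1; lra.
    by rewrite big_nat_recr//= ih exprS invfM; lra.
  by rewrite lerBlDr lerDl mulr_ge0// invr_ge0 exprn_ge0.
apply: filterS (integrable_ae measurableT iS) => x /(_ Logic.I) fx.
apply: normed_cvg; apply: nnseries_is_cvg => [k|]; first exact: normr_ge0.
by rewrite -ge0_fin_numE; [exact: fx|apply: nneseries_ge0 => k _ _; exact: G0].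
Qed.

Lemma ae_cvg0 (f : nat -> T -> R) (C : R) :
  (forall k, measurable_fun setT (f k)) ->
  (forall k, \int[mu]_x `|f k x|%:E <= (C * 2^-k)%:E)%E ->
  \forall x \ae mu, f k x @[k --> \oo] --> 0.
Proof.
move=> mf fC; apply: filterS (ae_cvg_series mf fC) => x.
exact: cvg_series_cvg_0.
Qed.

Lemma ae_cvg_cauchy (f : nat -> T -> R) (C : R) :
  (forall k, measurable_fun setT (f k)) ->
  (forall k, \int[mu]_x `|f k.+1 x - f k x|%:E <= (C * 2^-k)%:E)%E ->
  exists2 F : T -> R, measurable_fun setT F &
    \forall x \ae mu, f k x @[k --> \oo] --> F x.
Proof.
move=> mf fC.
(* The upper limit is measurable on the whole space; [fine] sends infinite values to 0, which
   matters only where the sequence diverges. *)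
exists (fun x => fine (limn_esup (fun k => (f k x)%:E))).
  apply: (measurableT_comp (fine_measurable _)) => //.
  apply: measurable_fun_limn_esup => k.
  exact/measurable_EFinP.
have mg k : measurable_fun setT (fun x => f k.+1 x - f k x).
  exact: measurable_funB.
apply: filterS (ae_cvg_series mg fC) => x cx.
have cf : cvgn (f ^~ x).
  have -> : f ^~ x = (fun k => f 0%N x + series (fun k => f k.+1 x - f k x) k).
    apply/funext => k; rewrite seriesEnat/= telescope_sumr//.
    by rewrite addrC subrK.
  by apply: is_cvgD => //; exact: is_cvg_cst.
have cE : (f k x)%:E @[k --> \oo] --> (limn (f ^~ x))%:E.
  by apply: cvg_EFin; [exact: nearW|exact: cf].
rewrite is_cvg_limn_esupE; last by apply/cvg_ex; eexists; exact: cE.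
by rewrite (cvg_lim _ cE).
Qed.

End ae_convergence.

(** * Pointwise meaning of the operations on classes modulo equality a.e *)

Section L0_theory.
Context d (T : measurableType d) (R : realType).
Variable mu : {measure set T -> \bar R}.
Local Notation L0 := {mfun_ mu, T >-> R}.
Implicit Types f g h : L0.

Lemma L0_measurable f : measurable_fun setT (f : T -> R).
Proof. exact: measurable_funPT. Qed.

Lemma L0P f g : f = g <-> \forall x \ae mu, f x = g x.
Proof.
split=> [->|fg]; first exact: aeW.
by rewrite -(ae_class_repr f) -(ae_class_repr g); apply/ae_classP.
Qed.

Lemma L0_of_fun (F : T -> R) : measurable_fun setT F ->
  exists f : L0, \forall x \ae mu, f x = F x.
Proof.
move=> mF; exists (ae_class mu (mfun_Sub (mem_set mF))).
exact: repr_ae_class.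
Qed.

Lemma L0_zeroE : \forall x \ae mu, (0 : L0) x = 0.
Proof. exact: (repr_ae_class mu 0). Qed.

Lemma L0_subE f g : \forall x \ae mu, (f - g : L0) x = f x - g x.
Proof.
rewrite -scaleN1r; apply: filterS2 (L0_addE f (-1 *: g)) (L0_scaleE (-1) g).
by move=> x -> ->; rewrite mulN1r.
Qed.

Lemma L0_sumE n (c : 'I_n -> R) (e : 'I_n -> L0) :
  \forall x \ae mu, (\sum_i c i *: e i : L0) x = \sum_i c i * e i x.
Proof.
elim: n c e => [|n ih] c e.
  by rewrite big_ord0; apply: filterS L0_zeroE => x ->; rewrite big_ord0.
rewrite big_ord_recl.
apply: filterS3 (L0_addE (c ord0 *: e ord0)
    (\sum_(i < n) c (lift ord0 i) *: e (lift ord0 i)))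
  (L0_scaleE (c ord0) (e ord0))
  (ih (fun i => c (lift ord0 i)) (fun i => e (lift ord0 i))) => x -> -> ->.
by rewrite big_ord_recl.
Qed.

End L0_theory.

Lemma norm_powR_cvg0 (R : realType) (p : R) (u : R ^nat) : 0 < p ->
  (`|u k| `^ p @[k --> \oo] --> (0 : R)) <-> (u k @[k --> \oo] --> 0).
Proof.
move=> p0; split=> /cvgr0_norm_lt u0; apply/cvgr0Pnorm_lt => e e0.
  near=> k; have : `| (`|u k| `^ p) | < e `^ p.
    by near: k; apply: u0; exact: powR_gt0.
  rewrite ger0_norm ?powR_ge0// ltNge; apply: contraNlt => eu.
  by rewrite ge0_ler_powR ?nnegrE ?(ltW p0) ?(ltW e0).
near=> k; have : `|u k| < e `^ p^-1.
  by near: k; apply: u0; exact: powR_gt0.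
move=> ue; rewrite ger0_norm ?powR_ge0//.
have -> : e = (e `^ p^-1) `^ p.
  by rewrite -powRrM mulVf ?gt_eqF// powRr1// ltW.
by rewrite gt0_ltr_powR ?nnegrE ?powR_ge0.
Unshelve. all: by end_near. Qed.

(** * Lebesgue norms and dominated convergence *)

Section Lp_theory.
Context d (T : measurableType d) (R : realType).
Variable mu : {measure set T -> \bar R}.
Local Notation L0 := {mfun_ mu, T >-> R}.
Implicit Types (F G H : T -> R) (f g h : L0) (p q : R).
Local Notation "'N_ p [ F ]" := (Lnorm mu p (EFin \o F)).

Lemma ae_eq_Lnorm (p : \bar R) F G :
  measurable_fun setT F -> measurable_fun setT G ->
  (\forall x \ae mu, F x = G x) -> ('N_p[F] = 'N_p[G])%E.
Proof.
move=> mF mG FG; rewrite unlock; case: p => [p||].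
- congr (_ `^ _)%E; apply: ge0_ae_eq_integral => //.
  + apply/measurable_EFinP; apply: (measurableT_comp (measurable_powR _)).
    exact: measurableT_comp.
  + apply/measurable_EFinP; apply: (measurableT_comp (measurable_powR _)).
    exact: measurableT_comp.
  + by move=> x _; rewrite lee_fin powR_ge0.
  + by move=> x _; rewrite lee_fin powR_ge0.
  + by apply: filterS FG => x /= ->.
- by case: ifP => // _; apply: eq_ess_sup; apply: filterS FG => x /= ->.
- by case: ifP => // _; apply: eq_ess_inf; apply: filterS FG => x /= ->.
Qed.

Lemma Lp_normK (p : \bar R) f : Lp p f ->
  'N_p[f : T -> R]%E = (Lp_norm p f)%:E.
Proof.
by move=> fp; rewrite fineK// ge0_fin_numE; [exact: fp|exact: Lnorm_ge0].
Qed.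

Lemma Lp_norm_ge0 (p : \bar R) f : 0 <= Lp_norm p f.
Proof. by rewrite fine_ge0// Lnorm_ge0. Qed.

Lemma Linf_ae_le f : Lp +oo f -> \forall x \ae mu, `|f x| <= Lp_norm +oo f.
Proof.
move=> /Lp_normK; rewrite unlock; case: ifPn => [mu0 fE|].
  have := ess_sup_ge mu (abse \o (EFin \o (f : T -> R))).
  by rewrite fE; apply: filterS => x /=; rewrite lee_fin.
(* On a null space the norm is 0 by convention, and every property holds a.e. *)
rewrite -leNgt => mu0 _; apply: measure0_ae.
by apply/eqP; rewrite eq_le mu0 measure_ge0.
Qed.

Lemma ae_le_Linf f (M : R) : (\forall x \ae mu, `|f x| <= M) -> Lp +oo f.
Proof.
move=> fM; rewrite /Lp /finite_norm /= unlock; case: ifP => // _.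
apply: (@le_lt_trans _ _ M%:E); last exact: ltry.
by apply/ess_supP; apply: filterS fM => x /=; rewrite lee_fin.
Qed.

Lemma integrable_powR F p : 0 < p -> measurable_fun setT F ->
  ('N_p%:E[F] < +oo)%E -> mu.-integrable setT (fun x => (`|F x| `^ p)%:E).
Proof.
move=> p0 mF Fp; apply/integrableP; split.
  apply/measurable_EFinP; apply: (measurableT_comp (measurable_powR _)).
  exact: measurableT_comp.
under eq_integral do rewrite gee0_abs ?lee_fin ?powR_ge0//.
have := poweR_Lnorm mu (EFin \o F) (lt0r_neq0 p0).
under eq_integral do rewrite /=.
by move=> <-; exact: poweR_lty.
Qed.

(** Dominated convergence with majorant (M |f|)^p, hence for finite p only. It serves with p = 1 for
    the test functions of the weak-* topology and with the conjugate exponent for [f0]. *)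
Lemma bounded_mul_Lp p f (h : nat -> T -> R) (M : R) : 1 <= p ->
  Lp p%:E f -> (forall k, measurable_fun setT (h k)) ->
  (forall k, \forall x \ae mu, `|h k x| <= M) ->
  [/\ forall k, ('N_p%:E[(fun x => f x * h k x)%R] < +oo)%E &
      (\forall x \ae mu, h k x @[k --> \oo] --> 0) ->
      fine 'N_p%:E[(fun x => f x * h k x)%R] @[k --> \oo] --> 0].
Proof.
move=> p1 fp mh hM; have p0 : 0 < p by rewrite (lt_le_trans ltr01).
have mf := L0_measurable f.
have mF k : measurable_fun setT (fun x => (`|f x * h k x| `^ p)%:E).
  apply/measurable_EFinP; apply: (measurableT_comp (measurable_powR _)).
  by apply: measurableT_comp => //; exact: measurable_funM.
pose G x := (M `^ p * `|f x| `^ p)%:E.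
have iG : mu.-integrable setT G.
  rewrite /G; under eq_fun do rewrite EFinM.
  by apply: integrableZl => //; exact: integrable_powR.
have FG k : \forall x \ae mu, (`|(`|f x * h k x| `^ p)%:E| <= G x)%E.
  apply: filterS (hM k) => x hx; have M0 := le_trans (normr_ge0 _) hx.
  rewrite gee0_abs; last by rewrite lee_fin powR_ge0.
  rewrite /G lee_fin.
  rewrite -powRM// ge0_ler_powR ?nnegrE ?mulr_ge0// ?(ltW p0)//.
  by rewrite [f x * _]mulrC normrM ler_wpM2r.
have NF k : ('N_p%:E[(fun x => f x * h k x)%R] `^ p =
             \int[mu]_x (`|f x * h k x| `^ p)%:E)%E.
  by rewrite powR_Lnorm ?gt_eqF.
have FN k : ('N_p%:E[(fun x => f x * h k x)%R] < +oo)%E.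
  apply: (@lty_poweRy _ _ p); first by rewrite gt_eqF.
  rewrite NF; apply: (@le_lt_trans _ _ (\int[mu]_x G x)%E).
    apply: ae_ge0_le_integral => //.
    - by move=> x _; rewrite /G lee_fin mulr_ge0 ?powR_ge0.
    - exact: measurable_int iG.
    - apply: filterS (FG k) => x + _.
      by rewrite gee0_abs// lee_fin powR_ge0.
  apply: le_lt_trans (integrable_lty _ iG) => //.
split => // h0.
have [] := @dominated_convergence _ _ _ mu setT measurableT
  (fun k x => (`|f x * h k x| `^ p)%:E) (cst 0%E) G mF.
- exact: measurable_cst.
- apply: filterS h0 => x hx _ /=.
  apply: cvg_EFin; first exact: nearW.
  apply/(norm_powR_cvg0 _ p0).
  rewrite -[X in _ --> X](mulr0 (f x)); apply: cvgM hx; exact: cvg_cst.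
- exact: iG.
- by apply: filterS (ae_foralln FG) => x hx n _; exact: hx.
move=> _ _ /=; rewrite integral0 => cI.
apply/(norm_powR_cvg0 _ p0).
under eq_fun do rewrite ger0_norm ?fine_ge0 ?Lnorm_ge0// -fine_poweR NF.
exact: fine_cvg cI.
Qed.

End Lp_theory.

(** * Linearity, monotonicity and Hoelder's inequality for integrals *)

Section L0_integration.
Context d (T : measurableType d) (R : realType).
Variable mu : {measure set T -> \bar R}.
Local Notation L0 := {mfun_ mu, T >-> R}.
Implicit Types (F G H : T -> R) (f g h : L0).
Local Notation "'N_ p [ F ]" := (Lnorm mu p (EFin \o F)).

Lemma ae_eq_integrable F G : measurable_fun setT F ->
  (\forall x \ae mu, F x = G x) -> mu.-integrable setT (EFin \o G) ->
  mu.-integrable setT (EFin \o F).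
Proof.
move=> mF FG iG; apply/integrableP; split; first exact/measurable_EFinP.
have /measurable_EFinP mG := measurable_int _ iG.
case/integrableP: iG => _; apply: le_lt_trans.
apply: ae_ge0_le_integral => //=.
- by apply/measurable_EFinP; exact: measurableT_comp.
- by apply/measurable_EFinP; exact: measurableT_comp.
- by apply: filterS FG => x /= ->.
Qed.

Lemma ae_eq_Rintegral F G : measurable_fun setT F -> measurable_fun setT G ->
  (\forall x \ae mu, F x = G x) -> \int[mu]_x F x = \int[mu]_x G x.
Proof.
move=> mF mG FG; congr fine; apply: ae_eq_integral => //.
- exact/measurable_EFinP.
- exact/measurable_EFinP.
- by apply: filterS FG => x /= ->.
Qed.

Lemma ae_le_Rintegral F G : mu.-integrable setT (EFin \o F) ->
  mu.-integrable setT (EFin \o G) -> (\forall x \ae mu, F x <= G x) ->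
  \int[mu]_x F x <= \int[mu]_x G x.
Proof.
move=> iF iG FG; rewrite -subr_ge0 -RintegralB//.
have iGF : mu.-integrable setT (EFin \o (fun x => G x - F x)).
  by apply: eq_integrable (integrableB measurableT iG iF).
have mGF : measurable_fun setT (fun x => G x - F x).
  exact/measurable_EFinP/(measurable_int _ iGF).
(* [Rintegral_ge0] asks for a sign at every point; G - F has it only a.e. and is replaced by its
   absolute value. *)
rewrite (@ae_eq_Rintegral _ (fun x => `|G x - F x|))//.
- by apply: Rintegral_ge0.
- exact: measurableT_comp.
- by apply: filterS FG => x FGx; rewrite ger0_norm// subr_ge0.
Qed.

(** A linear combination of classes is computed pointwise only a.e., so [F] is merely required to
    agree a.e. with the combination. *)
Lemma ae_linear_integral F G H (a : R) : measurable_fun setT F ->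
  (\forall x \ae mu, F x = a * G x + H x) ->
  mu.-integrable setT (EFin \o G) -> mu.-integrable setT (EFin \o H) ->
  mu.-integrable setT (EFin \o F) /\
  \int[mu]_x F x = a * (\int[mu]_x G x) + \int[mu]_x H x.
Proof.
move=> mF FE iG iH.
have iaG : mu.-integrable setT (EFin \o (fun x => a * G x)).
  by apply: eq_integrable (integrableZl measurableT a iG).
have iS : mu.-integrable setT (EFin \o (fun x => a * G x + H x)).
  by apply: eq_integrable (integrableD measurableT iaG iH).
split; first exact: ae_eq_integrable FE iS.
rewrite (ae_eq_Rintegral mF _ FE); last exact/measurable_EFinP/(measurable_int _ iS).
by rewrite RintegralD// RintegralZl.
Qed.

Lemma L0_hoelder (p : \bar R) f g : (1 < p)%E ->
  Lp (hoelder_conjugate p) f -> Lp p g ->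
  mu.-integrable setT (EFin \o (f * g : L0)) /\
  `|\int[mu]_x ((f * g : L0) x)| <=
    Lp_norm (hoelder_conjugate p) f * Lp_norm p g.
Proof.
move=> p1 fp gp; have mf := L0_measurable f; have mg := L0_measurable g.
have mfg := L0_measurable (f * g).
have mfg' : measurable_fun setT (fun x => f x * g x) by exact: measurable_funM.
suff le1 : ('N_1[((f * g)%R : L0) : T -> R] <=
            (Lp_norm (hoelder_conjugate p) f * Lp_norm p g)%:E)%E.
  rewrite Lnorm1 in le1.
  have ifg : mu.-integrable setT (EFin \o (f * g : L0)).
    apply/integrableP; split; first exact/measurable_EFinP.
    exact: le_lt_trans le1 (ltry _).
  split => //; rewrite -lee_fin; apply: le_trans le1.
  rewrite (le_trans (_ : _ <= (\int[mu]_x `|((f * g)%R : L0) x|)%:E)%E)//.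
    by rewrite lee_fin; exact: le_normr_Rintegral.
  by rewrite /Rintegral fineK// integrable_fin_num//; exact: integrable_norm.
rewrite (ae_eq_Lnorm _ mfg mfg' (L0_mulE f g)) EFinM -!Lp_normK//.
case: p p1 fp gp => [p||//] p1 fp gp.
  have p0 : 0 < p by rewrite (lt_trans ltr01).
  have -> : hoelder_conjugate p%:E = (p / (p - 1))%:E.
    by rewrite /hoelder_conjugate /= eqe gt_eqF// -EFinD inver subr_eq0 gt_eqF.
  apply: hoelder => //; first by rewrite divr_gt0 ?subr_gt0.
  by rewrite invf_div mulrBl mul1r mulfV ?gt_eqF// subrK.
(* For p = oo the conjugate exponent is 1 and the estimate is pointwise: |g| is at most its norm
   a.e. *)
rewrite hoelder_conjugatey in fp *.
rewrite [X in (_ <= _ * X)%E]Lp_normK// !Lnorm1 muleC -ge0_integralZl//; last first.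
- by rewrite lee_fin Lp_norm_ge0.
- by apply/measurable_EFinP; exact: measurableT_comp.
apply: ae_ge0_le_integral => //=.
- by apply/measurable_EFinP; exact: measurableT_comp.
- by move=> x _; rewrite lee_fin mulr_ge0// Lp_norm_ge0.
- by apply/measurable_EFinP; apply: measurable_funM => //; exact: measurableT_comp.
- apply: filterS (Linf_ae_le gp) => x gx _.
  by rewrite lee_fin mulrC normrM ler_wpM2r.
Qed.

Lemma Lnorm1_le_Lnorm2 F : measurable_fun setT F ->
  ('N_1[F] <= 'N_2%:E[F] * mu setT `^ 2^-1)%E.
Proof.
move=> mF; rewrite -Lnorm_cst1.
rewrite (@eq_Lnorm _ _ _ _ _ (EFin \o F) (EFin \o (F \* cst 1)%R)); last first.
  by move=> x /=; rewrite mulr1.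
by apply: hoelder => //; lra.
Qed.

Lemma Linf_Lp2 f : (mu setT < +oo)%E -> Lp +oo f -> Lp 2%:E f.
Proof.
move=> mufin fp; have : (f : T -> R) \in Lfun mu +oo%E.
  by rewrite inE; apply/andP; split; rewrite inE//=; exact: L0_measurable.
have m2 : (1 <= 2%:E :> \bar R)%E by rewrite lee_fin; lra.
move/(Lfun_subset m2 (leey _) _ (leey _)); rewrite ge0_fin_numE// => /(_ mufin).
by rewrite inE => /andP[_]; rewrite inE.
Qed.

Lemma ae_bounded_integrable F (M : R) : (mu setT < +oo)%E ->
  measurable_fun setT F -> (\forall x \ae mu, `|F x| <= M) ->
  mu.-integrable setT (EFin \o F).
Proof.
move=> mufin mF FM; apply/integrableP; split; first exact/measurable_EFinP.
apply: (@le_lt_trans _ _ (\int[mu]_x `|M%:E|)%E); last first.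
  by rewrite integral_cst//= lte_mul_pinfty.
apply: ae_ge0_le_integral => //=.
- by apply/measurable_EFinP; exact: measurableT_comp.
- by apply: filterS FM => x xM _; rewrite lee_fin (le_trans xM)// ler_norm.
Qed.

End L0_integration.
(** * Finite-dimensional sets of functions *)

Section finite_dimension.
Context d (T : measurableType d) (R : realType).
Variable mu : {measure set T -> \bar R}.
Hypothesis mufin : (mu setT < +oo)%E.
Local Notation L0 := {mfun_ mu, T >-> R}.

Lemma Lnorm2_sqr (f : L0) : ('N[mu]_2%:E[EFin \o (f : T -> R)] `^ 2 =
  \int[mu]_x `|(f x ^+ 2)%:E|)%E.
Proof.
rewrite poweR_Lnorm ?pnatr_eq0//; apply: eq_integral => x _.
by rewrite /= powR_mulrn// normrX.
Qed.

Lemma Lp2P (f : L0) : Lp 2%:E f <-> mu.-integrable setT (fun x => (f x ^+ 2)%:E).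
Proof.
split=> [f2|/integrableP[mf2 If2]].
  apply: Lfun2_integrable_sqr; rewrite inE; apply/andP; split; rewrite inE.
    exact: L0_measurable.
  exact: f2.
rewrite /Lp /finite_norm/=; apply: (@lty_poweRy _ _ 2); first by rewrite pnatr_eq0.
by rewrite Lnorm2_sqr.
Qed.

Lemma Lp_norm2_sqr (f : L0) : Lp 2%:E f ->
  Lp_norm 2%:E f ^+ 2 = \int[mu]_x (f x ^+ 2).
Proof.
move=> f2; rewrite -powR_mulrn ?Lp_norm_ge0// -fine_poweR Lnorm2_sqr.
congr fine; apply: eq_integral => x _.
by rewrite gee0_abs// lee_fin sqr_ge0.
Qed.

Definition lincomb n (e : 'I_n -> L0) (c : 'rV[R]_n) : L0 :=
  \sum_i c ord0 i *: e i.

Lemma lincombE n (e : 'I_n -> L0) c :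
  \forall x \ae mu, lincomb e c x = \sum_i c ord0 i * e i x.
Proof. exact: L0_sumE. Qed.

Lemma lincomb_linear n (e : 'I_n -> L0) : linear (lincomb e).
Proof.
move=> a b c; rewrite /lincomb scaler_sumr -big_split; apply: eq_bigr => i _ /=.
by rewrite !mxE scalerDl scalerA.
Qed.

Lemma in_finite_dim_L2_free (V : set L0) : in_finite_dim_L2 V ->
  exists n (e : 'I_n -> L0), [/\ forall i, Lp 2%:E (e i),
    V `<=` range (lincomb e) & forall c, lincomb e c = 0 -> c = 0].
Proof.
pose P n := `[< exists e : 'I_n -> L0, (forall i, Lp 2%:E (e i)) /\
    V `<=` range (lincomb e) >].
move=> [n [e [e2 Ve]]].
have exP : exists n, P n.
  exists n; apply/asboolP; exists e; split => // v /Ve[c ->].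
  by exists (\row_i c i) => //; apply: eq_bigr => i _; rewrite mxE.
case: (ex_minnP exP) => m /asboolP[f [f2 Vf]] mmin; exists m, f; split => // c.
move=> c0; apply/rowP => j; rewrite mxE; apply/eqP/negPn/negP => cj.
case: m f f2 Vf mmin c c0 j cj => [|m] f f2 Vf mmin c c0 j cj.
  by case: j cj.
suff /mmin : P m by rewrite ltnn.
apply/asboolP; exists (f \o lift j); split=> [i|v /Vf[b _ <-]].
  exact: f2.
(* Subtracting a multiple of the relation [c] cancels coordinate [j] without changing the
   combination. *)
pose b' := b - (b ord0 j / c ord0 j) *: c.
have b'j : b' ord0 j = 0 by rewrite !mxE divfK ?subrr.
have -> : lincomb f b = lincomb f b'.
  have := lincomb_linear f (- (b ord0 j / c ord0 j)) c b.
  by rewrite c0 scaler0 add0r scaleNr addrC => <-.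
exists (\row_i b' ord0 (lift j i)) => //.
rewrite /lincomb [RHS](bigD1_ord j)//= b'j scale0r add0r.
by apply: eq_bigr => i _; rewrite !mxE.
Qed.

(** The squared L2 norm of [lincomb e c] as the quadratic form of the Gram matrix; in this form its
    continuity in [c] is immediate. *)
Definition gram n (e : 'I_n -> L0) (c : 'rV[R]_n) : R :=
  \sum_i \sum_j c ord0 i * c ord0 j * \int[mu]_x (e i * e j : L0) x.

Lemma continuous_gram n (e : 'I_n -> L0) : continuous (gram e).
Proof.
apply: continuous_big => [|i _]; first exact: add_continuous.
apply: continuous_big => [|j _]; first exact: add_continuous.
move=> c; have FF : Filter (nbhs c) by exact: nbhs_filter.
have cc k : (fun c : 'rV[R]_n => c ord0 k) x @[x --> c] --> c ord0 k.
  exact: coord_continuous.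
exact: (@cvgM _ _ _ FF _ _ _ _ (@cvgM _ _ _ FF _ _ _ _ (cc i) (cc j)) (cvg_cst _)).
Qed.

Lemma gramE n (e : 'I_n -> L0) (c : 'rV[R]_n) : (forall i, Lp 2%:E (e i)) ->
  Lp 2%:E (lincomb e c) /\ Lp_norm 2%:E (lincomb e c) ^+ 2 = gram e c.
Proof.
move=> e2; have m2 : (1 < 2%:E :> \bar R)%E by rewrite lte_fin; lra.
have ie i j : mu.-integrable setT (EFin \o (e i * e j : L0)).
  by have [] := L0_hoelder m2 (f := e i) (g := e j); rewrite ?hoelder_conjugate2.
pose F i j x := c ord0 i * c ord0 j * (e i * e j : L0) x.
have iF i j : mu.-integrable setT (EFin \o F i j).
  by apply: eq_integrable (integrableZl measurableT (c ord0 i * c ord0 j) (ie i j)).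
have iS : mu.-integrable setT (fun x => \sum_i \sum_j (F i j x)%:E)%E.
  apply: integrable_sum => // i _; apply: integrable_sum => // j _.
  exact: iF.
have FE : \forall x \ae mu, lincomb e c x ^+ 2 = \sum_i \sum_j F i j x.
  have eE : \forall x \ae mu, forall i j, (e i * e j : L0) x = e i x * e j x.
    by apply: filter_forall => i; apply: filter_forall => j; exact: L0_mulE.
  apply: filterS2 (lincombE e c) eE => x -> eE.
  rewrite expr2 mulr_suml; apply: eq_bigr => i _.
  rewrite mulr_sumr; apply: eq_bigr => j _.
  by rewrite /F eE; ring.
have iF2 : mu.-integrable setT (EFin \o (fun x => \sum_i \sum_j F i j x)).
  apply: eq_integrable iS => // x _ /=.
  by rewrite -sumEFin; apply: eq_bigr => i _; rewrite -sumEFin.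
have mc2 : measurable_fun setT (fun x => lincomb e c x ^+ 2).
  by apply: measurable_funX; exact: L0_measurable.
have c2 : Lp 2%:E (lincomb e c).
  by apply/Lp2P; exact: ae_eq_integrable FE iF2.
split => //; rewrite Lp_norm2_sqr// (ae_eq_Rintegral mc2 _ FE); last first.
  exact/measurable_EFinP/(measurable_int _ iF2).
transitivity (fine (\int[mu]_x (\sum_i \sum_j (F i j x)%:E))%E).
  congr fine; apply: eq_integral => x _.
  by rewrite -sumEFin; apply: eq_bigr => i _; rewrite -sumEFin.
rewrite integral_sum//; last first.
  by move=> i; apply: integrable_sum => // j _; exact: iF.
apply: EFin_inj; rewrite fineK; last first.
  apply/sum_fin_numP => i _ _; apply: integrable_fin_num => //.
  by apply: integrable_sum => // j _; exact: iF.
rewrite /gram -sumEFin; apply: eq_bigr => i _.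
rewrite integral_sum//; last by move=> j; exact: iF.
rewrite -sumEFin; apply: eq_bigr => j _.
by rewrite -RintegralZl// /Rintegral fineK// integrable_fin_num//; exact: iF.
Qed.

End finite_dimension.

(** * Closedness of the convex hull of the control set *)

Section closed_hull.
Context d (T : measurableType d) (R : realType).
Variable mu : {measure set T -> \bar R}.
Hypothesis mufin : (mu setT < +oo)%E.
Local Notation L0 := {mfun_ mu, T >-> R}.

Lemma gram_ge0 n (e : 'I_n -> L0) c : (forall i, Lp 2%:E (e i)) ->
  0 <= gram e c.
Proof. by move=> /(gramE c)[_ <-]; exact: sqr_ge0. Qed.

Lemma gramZ n (e : 'I_n -> L0) a c : gram e (a *: c) = a ^+ 2 * gram e c.
Proof.
rewrite /gram mulr_sumr; apply: eq_bigr => i _.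
by rewrite mulr_sumr; apply: eq_bigr => j _; rewrite !mxE; ring.
Qed.

Lemma Lp_norm2_eq0 (f : L0) : Lp 2%:E f -> Lp_norm 2%:E f = 0 -> f = 0.
Proof.
move=> f2 f0; apply/L0P.
have := Lnorm_eq0_eq0 (mu := mu) (f := EFin \o (f : T -> R)) (p := 2%:E).
rewrite Lp_normK// f0 => /(_ _ _ erefl) h.
have mf : measurable_fun setT (EFin \o (f : T -> R)).
  by apply/measurable_EFinP; exact: L0_measurable.
have /(h mf) : (0 < 2%:E :> \bar R)%E by rewrite lte_fin.
apply: filterS2 (L0_zeroE mu) => x -> /(_ Logic.I) /= fx.
exact: EFin_inj.
Qed.

(** By freeness the quadratic form is positive on the compact unit sphere; its minimum there is the
    constant, by homogeneity of degree two. *)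
Lemma gram_lower_bound n (e : 'I_n -> L0) : (forall i, Lp 2%:E (e i)) ->
  (forall c, lincomb e c = 0 -> c = 0) ->
  exists2 b, 0 < b & forall c : 'rV[R]_n, b * `|c| ^+ 2 <= gram e c.
Proof.
move=> e2 free; pose S := [set c : 'rV[R]_n | `|c| = 1].
(* If the sphere is empty, the dimension is zero and any constant works. *)
have [S0|S0] := pselect (S !=set0); last first.
  exists 1 => // c; have [->|c0] := eqVneq c 0.
    by rewrite normr0 expr0n mulr0 gram_ge0.
  case: S0; exists (`|c|^-1 *: c); rewrite /S/= normrZ ger0_norm//.
  by rewrite mulVf ?normr_eq0.
have cS : compact S.
  apply: bounded_closed_compact.
    by exists 1; split; [exact: num_real|move=> M M1 c /= ->; exact: ltW].
  rewrite (_ : S = Num.norm @^-1` [set 1])//; apply: preimage_closed.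
    by move=> c _; exact: norm_continuous.
  exact: closed_eq.
have [|b bS bP] := EVT_min_rV S0 cS (f := gram e).
  by apply: continuous_subspaceT; exact: continuous_gram.
have b0 : 0 < gram e b.
  rewrite lt_neqAle gram_ge0// andbT eq_sym; apply/negP => /eqP gb0.
  have [b2 bE] := gramE b e2.
  have /free b0 : lincomb e b = 0.
    apply: Lp_norm2_eq0 => //; apply/eqP.
    by rewrite -sqrf_eq0 bE gb0.
  by move: bS; rewrite inE /S/= b0 normr0 => /esym/eqP; rewrite oner_eq0.
exists (gram e b) => // c; have [->|c0] := eqVneq c 0.
  by rewrite normr0 expr0n mulr0 gram_ge0.
have nc : 0 < `|c| by rewrite normr_gt0.
have : gram e b <= gram e (`|c|^-1 *: c).
  by apply: bP; rewrite inE /S/= normrZ ger0_norm// mulVf// gt_eqF.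
by rewrite gramZ exprVn mulrC ler_pdivlMr ?exprn_gt0.
Qed.

(** A function approximated by members of [S] is at distance zero from its nearest point [P v],
    hence equals it. *)
Lemma metric_projection_closed (S : set L0) P (v : L0) : metric_projection S P ->
  Lp 2%:E v -> (forall s, S s -> Lp 2%:E s) ->
  (forall eps, 0 < eps -> exists2 s, S s & Lp_norm 2%:E (v - s) ^+ 2 < eps) ->
  Lp 2%:E (v - P v) -> S v.
Proof.
move=> hP v2 S2 vS d2; have [SPv Pv] := hP v v2.
suff /(Lp_norm2_eq0 d2)/eqP : Lp_norm 2%:E (v - P v) = 0.
  by rewrite subr_eq0 => /eqP ->.
apply/eqP; rewrite -sqrf_eq0; apply/eqP/le_anti; rewrite sqr_ge0 andbT.
apply/ler_addgt0Pl => eps eps0; have [s Ss sv] := vS eps eps0.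
rewrite addr0 (le_trans _ (ltW sv))// lerXn2r ?nnegrE ?Lp_norm_ge0//.
exact: Pv.
Qed.

(** In coordinates the hull is compact, so the coordinates of the [w_ k] have a cluster point in it;
    evaluation at almost every point shows that this cluster point represents [w]. *)
Lemma closed_convex_hull (S V : set L0) P (M : R) :
  in_finite_dim_L2 V -> S `<=` V -> metric_projection S P ->
  (forall s, S s -> \forall x \ae mu, `|s x| <= M) ->
  forall (w_ : nat -> L0) (w : L0), (forall k, convex_hull S (w_ k)) ->
  (\forall x \ae mu, w_ k x @[k --> \oo] --> w x) -> convex_hull S w.
Proof.
move=> /in_finite_dim_L2_free[n [e [e2 Ve free]]] SV hP SM w_ w Sw_ w_w.
have lphi := lincomb_linear e.
pose K := lincomb e @^-1` S.
have SE : S = lincomb e @` K.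
  apply/seteqP; split => [s Ss|_ [c Kc <-]//].
  by have [c _ cs] := Ve s (SV _ Ss); exists c => //; rewrite /K/= cs.
have lphiB a b : lincomb e a - lincomb e b = lincomb e (a - b).
  by have := lphi (-1) b a; rewrite !scaleN1r => /esym; rewrite addrC [- b + a]addrC.
have [b b0 bP] := gram_lower_bound e2 free.
have bK : bounded_set K.
  (* [B] bounds the squared coordinate norm, through the Gram form and the uniform bound [M]; the
     norm itself is then at most 1 + B, whether or not it exceeds 1. *)
  pose B := M ^+ 2 * fine (mu setT) / b.
  exists (1 + B); split; first exact: num_real.
  move=> r Br c Kc /=; apply: le_trans (ltW Br).
  have cB : `|c| ^+ 2 <= B.
    rewrite ler_pdivlMr// mulrC (le_trans (bP c))//.
    have [c2 <-] := gramE c e2.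
    rewrite Lp_norm2_sqr// -Rintegral_cst//.
    apply: ae_le_Rintegral.
    - exact/Lp2P.
    - by apply: (ae_bounded_integrable (M := `|M ^+ 2|)) => //; exact: aeW.
    - apply: filterS (SM _ Kc) => x xM.
      by rewrite -real_normK ?num_real// lerXn2r ?nnegrE// (le_trans _ xM).
  have [c1|c1] := leP `|c| 1.
    by rewrite (le_trans c1)// lerDl (le_trans _ cB)// sqr_ge0.
  rewrite (le_trans _ (le_trans cB _)) ?lerDr//.
  by rewrite expr2 ler_peMr// ltW.
have cK : closed K.
  move=> c Kc; have c2 := (gramE c e2).1.
  have S2 s : S s -> Lp 2%:E s.
    by rewrite SE => -[c' _ <-]; exact: (gramE c' e2).1.
  apply: (metric_projection_closed hP c2 S2); last first.
    have [SPc _] := hP _ c2; move: SPc; rewrite SE => -[c' _ <-].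
    by rewrite lphiB; exact: (gramE _ e2).1.
  move=> eps eps0.
  have : nbhs c [set c' | gram e (c - c') < eps].
    have g0 : gram e (c - c) < eps.
      by rewrite subrr -(scale0r 0) gramZ expr0n mul0r.
    have cB : {for c, continuous (fun c' : 'rV[R]_n => (c : 'rV[R]_n) - c')}.
      have FF : Filter (nbhs c) by exact: nbhs_filter.
      exact: (@cvgB _ _ _ _ FF _ _ _ _ (cvg_cst _) cvg_id).
    have cg := continuous_comp cB (@continuous_gram _ _ _ mu _ e (c - c)).
    exact: (cvgr_lt _ cg _ g0).
  move=> /Kc[c' [Kc' /= cc']]; exists (lincomb e c') => //.
  by rewrite lphiB (gramE _ e2).2.
have cH := compact_convex_hull (bounded_closed_compact bK cK).
have HE : convex_hull S = lincomb e @` convex_hull K.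
  by rewrite {1}SE convex_hull_image.
have /choice[c_ cP] : forall k, exists c, convex_hull K c /\ lincomb e c = w_ k.
  by move=> k; have := Sw_ k; rewrite HE => -[c Kc cw]; exists c.
have [c [Kc clc]] : convex_hull K `&` cluster (c_ @ \oo) !=set0.
  by apply: cH; exists 0%N => // k _; exact: (cP k).1.
rewrite HE; exists c => //; apply/L0P.
have eE := ae_foralln (fun k => lincombE e (c_ k)).
apply: filterS3 (lincombE e c) eE w_w => x -> eE w_w.
pose g (c : 'rV[R]_n) := \sum_i c ord0 i * e i x.
have cg : continuous g.
  apply: continuous_big => [|i _]; first exact: add_continuous.
  move=> a; have FF : Filter (nbhs a) by exact: nbhs_filter.
  exact: (@cvgM _ _ _ FF _ _ _ _ (@coord_continuous _ _ _ ord0 i a) (cvg_cst _)).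
(* The values g(c_k) = w_k(x) converge to w(x) and, by continuity of [g], have g(c) as a cluster
   value, so the two agree. *)
apply/eqP; rewrite -subr_eq0 -normr_eq0; apply/eqP/le_anti.
rewrite normr_ge0 andbT; apply/ler_addgt0Pl => eps eps0; rewrite addr0.
have h0 : 0 < eps / 2 by rewrite divr_gt0.
have nc : nbhs c [set c' | `|g c - g c'| < eps / 2].
  by have /cvgrPdist_lt/(_ _ h0) := cg c.
have nw : (c_ @ \oo) [set c' | `|w x - g c'| < eps / 2].
  move/cvgrPdist_lt : w_w => /(_ _ h0); apply: filterS => k /=.
  by rewrite -(cP k).2 eE.
have [c' [/= wc' gc']] := clc _ _ nw nc.
rewrite -(subrKA (g c')) (le_trans (ler_normD _ _))// [leRHS](splitr eps).
by rewrite lerD ?ltW// distrC.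
Qed.

End closed_hull.

(** The domain lies in a cube, whose measure is a product of side lengths. Half the side is M + 1
    because [bounded_set] grants only radii above M. *)
Lemma dom_measure_lty (R : realType) n (Omega : lipschitz_domain R n) :
  (dom_measure Omega setT < +oo)%E.
Proof.
have [M [_ MO]] := dom_bounded Omega.
pose B : 'I_n.+1 -> set R := fun=> `[- (M + 1), M + 1]%classic.
have mB i : measurable (B i) by exact: measurable_itv.
have cbox : closed [set x : 'rV[R]_n.+1 | forall i, B i (x ord0 i)].
  rewrite (_ : mkset _ =
      \bigcap_i ((fun x : 'rV[R]_n.+1 => x ord0 i) @^-1` B i)); last first.
    by apply/seteqP; split => x /= Bx i; [move=> _|]; exact: Bx.
  apply: closed_bigI => i _; apply: preimage_closed; last exact: itv_closed.
  by move=> x _; exact: coord_continuous.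
have mbox : measurable ([set x | forall i, B i (x ord0 i)] : set (Rn R n.+1)).
  rewrite -[X in measurable X]setCK; apply: measurableC.
  by apply: open_measurable_Rn; exact: closed_openC.
rewrite /dom_measure /= /mrestr setTI.
apply: (@le_lt_trans _ _
  (lebesgue_Rn [set x : 'rV[R]_n.+1 | forall i, B i (x ord0 i)])).
  apply: le_measure; rewrite ?inE.
  - by apply: open_measurable_Rn; exact: dom_open.
  - exact: mbox.
  move=> x Ox i; have := MO (M + 1); rewrite ltrDl ltr01 => /(_ isT x Ox).
  rewrite /B/= in_itv/= -ler_norml; apply: le_trans.
  rewrite [leRHS]/Num.norm /= mx_normrE; apply/bigmax_geP; right => /=.
  by exists (ord0, i).
rewrite lebesgue_Rn_box//.
have -> : (\prod_(i < n.+1) lebesgue_measure (B i) =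
           (\prod_(i < n.+1) fine (lebesgue_measure (B i)))%:E)%E.
  rewrite -prodEFin; apply: eq_bigr => i _; rewrite fineK// /B.
  rewrite lebesgue_measure_itv /=; case: ifP => //.
exact: ltry.
Qed.
(** * Bounded sequences of functions *)

Lemma le_of_expn (R : realType) (a b c : R) :
  (forall k, a <= b + c * 2^-k) -> a <= b.
Proof.
move=> h; apply/ler_addgt0Pr => e e0.
have e'0 : 0 < e / (1 + `|c|) by rewrite divr_gt0// ltr_pwDl.
have [N _ /(_ N (leqnn N))] := near_infty_natSinv_expn_lt (PosNum e'0).
rewrite /= mul1r ltr_pdivlMr ?ltr_pwDl// => he.
rewrite (le_trans (h N))// lerD2l (le_trans _ (ltW he))// mulrC.
rewrite ler_wpM2l ?invr_ge0 ?exprn_ge0// (le_trans (ler_norm _))// lerDr//.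
Qed.

Section mean_square.
Context d (T : measurableType d) (R : realType).
Variable mu : {measure set T -> \bar R}.
Hypothesis mufin : (mu setT < +oo)%E.
Local Notation L0 := {mfun_ mu, T >-> R}.
Implicit Types (F : T -> R) (f g h w z : L0).

Lemma convex_hull_ae_le (S : set L0) (M : R) w :
  (forall s, S s -> \forall x \ae mu, `|s x| <= M) -> convex_hull S w ->
  \forall x \ae mu, `|w x| <= M.
Proof.
move=> SM [n [l [s [l0 l1 Ss ->]]]].
have sM : \forall x \ae mu, forall i, `|(s i : L0) x| <= M.
  by apply: filter_forall => i; exact: SM.
apply: filterS2 (L0_sumE l s) sM => x -> sM.
rewrite (le_trans (ler_norm_sum _ _ _))// -[leRHS]mul1r -l1 mulr_suml.
by apply: ler_sum => i _; rewrite normrM ger0_norm// ler_wpM2l.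
Qed.

Lemma bounded_sqr_integrable F (M : R) : measurable_fun setT F ->
  (\forall x \ae mu, `|F x| <= M) ->
  mu.-integrable setT (EFin \o (fun x => F x ^+ 2)) /\
  \int[mu]_x (F x ^+ 2) <= M ^+ 2 * fine (mu setT).
Proof.
move=> mF FM.
have F2 : \forall x \ae mu, F x ^+ 2 <= M ^+ 2.
  apply: filterS FM => x xM.
  by rewrite -real_normK ?num_real// lerXn2r ?nnegrE// (le_trans _ xM).
have iF : mu.-integrable setT (EFin \o (fun x => F x ^+ 2)).
  apply: (ae_bounded_integrable (M := M ^+ 2)) => //.
    exact: measurable_funX.
  by apply: filterS F2 => x; rewrite ger0_norm// sqr_ge0.
split => //; rewrite -Rintegral_cst//; apply: ae_le_Rintegral => //.
by apply: (ae_bounded_integrable (M := `|M ^+ 2|)) => //; exact: aeW.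
Qed.

Lemma ae_bounded_sub f g (M : R) :
  (\forall x \ae mu, `|f x| <= M) -> (\forall x \ae mu, `|g x| <= M) ->
  \forall x \ae mu, `|f x - g x| <= 2 * M.
Proof.
apply: filterS2 => x fM gM; rewrite (le_trans (ler_normB _ _))//.
by rewrite mulrDl mul1r lerD.
Qed.

(** The parallelogram identity ((f + g)/2)^2 = (f^2 + g^2)/2 - (g - f)^2/4, integrated; the uniform
    bounds make every term integrable. *)
Lemma midpoint_sqr_integral f g (M : R) :
  (\forall x \ae mu, `|f x| <= M) -> (\forall x \ae mu, `|g x| <= M) ->
  \int[mu]_x ((2^-1 *: f + (1 - 2^-1) *: g : L0) x ^+ 2) =
  (\int[mu]_x (f x ^+ 2) + \int[mu]_x (g x ^+ 2)) / 2 -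
  (\int[mu]_x ((g x - f x) ^+ 2)) / 4.
Proof.
move=> fM gM; have mf := L0_measurable f; have mg := L0_measurable g.
have [if2 _] := bounded_sqr_integrable mf fM.
have [ig2 _] := bounded_sqr_integrable mg gM.
have mgf : measurable_fun setT (fun x => g x - f x) by exact: measurable_funB.
have [igf _] := bounded_sqr_integrable mgf (ae_bounded_sub gM fM).
(* The zero summand brings the term into the form a * G + H of [ae_linear_integral], which is
   applied three times. *)
pose H x := 2^-1 * g x ^+ 2 + 0.
have mH : measurable_fun setT H.
  apply: measurable_funD; last exact: measurable_cst.
  by apply: measurable_funM; [exact: measurable_cst|exact: measurable_funX].
have [iH EH] := ae_linear_integral (a := 2^-1) mH (aeW _ (fun=> erefl)) ig2
  (integrable0 mu setT).
pose H' x := - 4^-1 * (g x - f x) ^+ 2 + H x.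
have mH' : measurable_fun setT H'.
  apply: measurable_funD => //.
  by apply: measurable_funM; [exact: measurable_cst|exact: measurable_funX].
have [iH' EH'] := ae_linear_integral (a := - 4^-1) mH' (aeW _ (fun=> erefl))
  igf iH.
set m : L0 := 2^-1 *: f + _.
have mm : measurable_fun setT (fun x => m x ^+ 2).
  by apply: measurable_funX; exact: L0_measurable.
have mE : \forall x \ae mu, m x ^+ 2 = 2^-1 * f x ^+ 2 + H' x.
  apply: filterS3 (L0_addE (2^-1 *: f) ((1 - 2^-1) *: g))
    (L0_scaleE 2^-1 f) (L0_scaleE (1 - 2^-1) g) => x -> -> ->.
  by rewrite /H' /H; field.
have [_ ->] := ae_linear_integral mm mE if2 iH'.
have I0 : \int[mu]_x 0 = 0 :> R by rewrite Rintegral_cst// mul0r.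
rewrite EH' EH I0; lra.
Qed.

(** Integrate |F| <= 2^k F^2 / 2 + 2^-k / 2, a weighted inequality of means whose weight puts both
    terms at order 2^-k. The factor 4 in the hypothesis undoes the quarter of the parallelogram
    identity. *)
Lemma integral_norm_le_sqr F (M : R) k : measurable_fun setT F ->
  (\forall x \ae mu, `|F x| <= M) ->
  \int[mu]_x (F x ^+ 2) <= 4 * (2^-k) ^+ 2 ->
  (\int[mu]_x `|F x|%:E <= ((2 + fine (mu setT) / 2) * 2^-k)%:E)%E.
Proof.
move=> mF FM F2; have [iF2 _] := bounded_sqr_integrable mF FM.
have mnF : measurable_fun setT (fun x => `|F x|) by exact: measurableT_comp.
have inF : mu.-integrable setT (EFin \o (fun x => `|F x|)).
  apply: (ae_bounded_integrable (M := M)) => //.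
  by apply: filterS FM => x; rewrite normr_id.
have icst : mu.-integrable setT (EFin \o cst (2^-k / 2)).
  by apply: (ae_bounded_integrable (M := `|2^-k / 2|)) => //; exact: aeW.
have p2 : 0 < 2 ^+ k :> R by rewrite exprn_gt0.
pose G x := 2 ^+ k / 2 * F x ^+ 2 + 2^-k / 2.
have mG : measurable_fun setT G.
  apply: measurable_funD; last exact: measurable_cst.
  by apply: measurable_funM; [exact: measurable_cst|exact: measurable_funX].
have [iG GE] := ae_linear_integral (a := 2 ^+ k / 2) mG (aeW _ (fun=> erefl))
  iF2 icst.
have -> : (\int[mu]_x `|F x|%:E = (\int[mu]_x `|F x|)%:E)%E.
  by rewrite /Rintegral fineK// integrable_fin_num.
rewrite lee_fin (@le_trans _ _ (\int[mu]_x G x))//.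
  apply: ae_le_Rintegral => //; apply: aeW => x.
  have : 0 <= (2 ^+ k * `|F x| - 1) ^+ 2 by exact: sqr_ge0.
  rewrite /G -[F x ^+ 2]real_normK ?num_real//.
  have -> : 2 ^+ k / 2 * `|F x| ^+ 2 + 2^-k / 2 =
    `|F x| + ((2 ^+ k * `|F x| - 1) ^+ 2) / (2 * 2 ^+ k).
    by field; rewrite gt_eqF.
  by move=> h; rewrite lerDl divr_ge0// mulr_ge0// ltW.
rewrite GE Rintegral_cst//.
have : 2 ^+ k / 2 * (\int[mu]_x (F x ^+ 2)) <= 2 ^+ k / 2 * (4 * 2^-k ^+ 2).
  by rewrite ler_pM2l// divr_gt0.
have -> : 2 ^+ k / 2 * (4 * 2^-k ^+ 2) = 2 * 2^-k :> R.
  by field; rewrite gt_eqF.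
by lra.
Qed.

Lemma Rintegral_le_Lnorm1 F : measurable_fun setT F ->
  ('N[mu]_1[EFin \o F] < +oo)%E ->
  mu.-integrable setT (EFin \o F) /\
  `|\int[mu]_x F x| <= fine 'N[mu]_1[EFin \o F]%E.
Proof.
move=> mF; rewrite Lnorm1 => F1.
have iF : mu.-integrable setT (EFin \o F).
  by apply/integrableP; split => //; exact/measurable_EFinP.
by split => //; exact: le_normr_Rintegral.
Qed.

(** Against each L1 test function the integrals of z - z_k tend to zero by dominated convergence,
    and a basic neighbourhood involves only finitely many test functions. *)
Lemma weak_star_closed_ae (Z : set L0) (z_ : nat -> L0) z (M : R) :
  weak_star_closed Z -> (forall k, Z (z_ k)) ->
  (forall k, \forall x \ae mu, `|z_ k x| <= M) ->
  (\forall x \ae mu, `|z x| <= M) ->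
  (\forall x \ae mu, z_ k x @[k --> \oo] --> z x) -> Z z.
Proof.
move=> cZ Zz_ z_M zM z_z; apply: cZ; first exact: ae_le_Linf zM.
move=> n g e g1 e0.
have mh k : measurable_fun setT (fun x => z x - z_ k x).
  by apply: measurable_funB; exact: L0_measurable.
have hM k : \forall x \ae mu, `|z x - z_ k x| <= 2 * M.
  exact: ae_bounded_sub.
have h0 : \forall x \ae mu, z x - z_ k x @[k --> \oo] --> 0.
  apply: filterS z_z => x zx.
  by rewrite -(subrr (z x)); apply: cvgB zx; exact: cvg_cst.
have gN i : \forall k \near \oo,
    `|\int[mu]_x (((z - z_ k) * g i : L0) x)| < e.
  have [Nfin /(_ h0) N0] := bounded_mul_Lp (lexx 1) (g1 i) mh hM.
  have /cvgr0_norm_lt/(_ _ e0) := N0.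
  apply: filterS => k /(le_lt_trans (ler_norm _)) Nk.
  have mp : measurable_fun setT ((z - z_ k) * g i : L0).
    exact: L0_measurable.
  have mp' : measurable_fun setT (fun x => g i x * (z x - z_ k x)).
    by apply: measurable_funM => //; exact: L0_measurable.
  have pE : \forall x \ae mu,
      ((z - z_ k) * g i : L0) x = g i x * (z x - z_ k x).
    apply: filterS2 (L0_mulE (z - z_ k) (g i)) (L0_subE z (z_ k)) => x -> ->.
    by rewrite mulrC.
  rewrite (ae_eq_Rintegral mp mp' pE); apply: le_lt_trans Nk.
  exact: (Rintegral_le_Lnorm1 mp' (Nfin k)).2.
have [N _ hN] := filter_forall _ gN.
by exists (z_ N) => // i; exact: hN N (leqnn N) i.
Qed.

End mean_square.
(** * The state equation *)

Lemma dual_norm_bound (R : realType) (U : normedModType R) (f : U -> R^o)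
    (B : R) :
  (forall x, `|x| <= 1 -> `|f x| <= B) -> 0 <= dual_norm f <= B.
Proof.
move=> fB; have S0 : [set `|f x| | x in [set x : U | `|x| <= 1]] `|f 0|.
  by exists 0 => //=; rewrite normr0.
have ubB : ubound [set `|f x| | x in [set x : U | `|x| <= 1]] B.
  by move=> _ [x x1 <-]; exact: fB.
apply/andP; split; last by apply: ge_sup => //; exists `|f 0|.
apply: (le_trans (normr_ge0 (f 0))).
by apply: ub_le_sup => //; exists B.
Qed.

Lemma bounded_linear_dual (R : realType) (U : normedModType R) (f : U -> R^o)
    (C : R) :
  linear f -> (forall x, `|f x| <= C * `|x|) -> dual f.
Proof.
move=> lf fC; split => // x; apply/cvgrPdist_le => e e0.
have C1 : 0 < 1 + `|C| by rewrite ltr_pwDl.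
have h0 : 0 < e / (1 + `|C|) by rewrite divr_gt0.
apply: filterS (nbhsx_ballx x _ h0) => y; rewrite -ball_normE /= => xy.
have -> : f x - f y = f (x - y).
  by have := lf (-1) y x; rewrite !scaleN1r [- y + x]addrC [- f y + _]addrC.
rewrite (le_trans (fC _))// mulrC.
move: xy; rewrite ltr_pdivlMr// => /ltW; apply: le_trans.
by rewrite ler_wpM2l// (le_trans (ler_norm _))// lerDr.
Qed.

Lemma dual_sub (R : realType) (U : normedModType R) (f g : U -> R^o) :
  dual f -> dual g -> dual (f - g).
Proof.
move=> [lf cf] [lg cg]; split => [a u v|x].
  change (f (a *: u + v) - g (a *: u + v) = a *: (f u - g u) + (f v - g v)).
  by rewrite lf lg scalerBr opprD addrACA.
by apply: continuousB; [exact: cf|exact: cg].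
Qed.

Lemma L0_scalerAl d (T : measurableType d) (R : realType)
    (mu : {measure set T -> \bar R}) a (f g : {mfun_ mu, T >-> R}) :
  (a *: f) * g = a *: (f * g).
Proof.
apply/L0P.
have fgE : \forall x \ae mu,
    (a *: (f * g) : {mfun_ mu, T >-> R}) x = a * (f x * g x).
  by apply: filterS2 (L0_scaleE a (f * g)) (L0_mulE f g) => x -> ->.
apply: filterS3 (L0_mulE (a *: f) g) (L0_scaleE a f) fgE => x -> -> ->.
by rewrite mulrA.
Qed.

Lemma L0_linear_integral d (T : measurableType d) (R : realType)
    (mu : {measure set T -> \bar R}) a (g h : {mfun_ mu, T >-> R}) :
  mu.-integrable setT (EFin \o g) -> mu.-integrable setT (EFin \o h) ->
  mu.-integrable setT (EFin \o (a *: g + h : {mfun_ mu, T >-> R})) /\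
  \int[mu]_x ((a *: g + h : {mfun_ mu, T >-> R}) x) =
    a * (\int[mu]_x g x) + \int[mu]_x h x.
Proof.
apply: ae_linear_integral; first exact: L0_measurable.
by apply: filterS2 (L0_addE (a *: g) h) (L0_scaleE a g) => x -> ->.
Qed.

(** Among the exponents p >= 1 only p = 1 has an infinite conjugate, for which dominated convergence
    in norm would fail. *)
Lemma hoelder_conjugate_fin (R : realType) (p : \bar R) : (1 < p)%E ->
  exists2 q : R, 1 <= q & hoelder_conjugate p = q%:E.
Proof.
move=> p1; have := hoelder_conj_ge1 (ltW p1).
case E : (hoelder_conjugate p) => [q||]//; first by rewrite lee_fin; exists q.
by move/hoelder_conjugate_eqy : E => p1'; rewrite p1' ltxx in p1.
Qed.

Section pairing.
Context d (T : measurableType d) (R : realType).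
Variable mu : {measure set T -> \bar R}.
Local Notation L0 := {mfun_ mu, T >-> R}.
Variables (U : normedModType R) (iota : {linear U -> L0}) (f0 : L0).

(** The zero-order term of [state_eq], which is, up to conversion, [integrable_source z] together
    with [A u + source z = f1]. *)
Definition source (z : L0) : U -> R^o :=
  fun v => \int[mu]_x ((f0 * z * iota v : L0) x).

Definition integrable_source (z : L0) :=
  forall v, mu.-integrable setT (EFin \o (f0 * z * iota v : L0)).

Lemma source_linear_comb a z z' :
  integrable_source z -> integrable_source z' ->
  integrable_source (a *: z + z') /\
  source (a *: z + z') = a *: source z + source z'.
Proof.
move=> iz iz'.
have E v : f0 * (a *: z + z') * iota v =
    a *: (f0 * z * iota v) + f0 * z' * iota v.
  by rewrite mulrDr mulrDl [f0 * (a *: z)]mulrC !L0_scalerAl [z * f0]mulrC.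
split=> [v|]; first by rewrite E; exact: (L0_linear_integral a (iz v) (iz' v)).1.
apply/funext => v; rewrite /source E.
exact: (L0_linear_integral a (iz v) (iz' v)).2.
Qed.

Lemma source_linear z : integrable_source z -> linear (source z).
Proof.
move=> iz a u v.
have E : f0 * z * iota (a *: u + v) =
    a *: (f0 * z * iota u) + f0 * z * iota v.
  by rewrite linearP mulrDr [X in X + _]mulrC L0_scalerAl [iota u * _]mulrC.
by rewrite /source E; exact: (L0_linear_integral a (iz u) (iz v)).2.
Qed.

Variables (p : \bar R) (C : R).
Hypothesis p1 : (1 < p)%E.
Hypothesis iota_bounded :
  forall u, Lp p (iota u) /\ Lp_norm p (iota u) <= C * `|u|.
Hypothesis f0q : Lp (hoelder_conjugate p) f0.

(** Boundedness of [z] keeps [f0 * z] in the conjugate space, where Hoelder's inequality pairs it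
    with the embedded [v]. *)
Lemma source_bound (z : L0) (M : R) : (\forall x \ae mu, `|z x| <= M) ->
  integrable_source z /\
  forall v, `|source z v| <=
    Lp_norm (hoelder_conjugate p) (f0 * z) * C * `|v|.
Proof.
move=> zM; have [q q1 qE] := hoelder_conjugate_fin p1.
have f0z : Lp (hoelder_conjugate p) (f0 * z).
  have f0q' := f0q; rewrite qE in f0q' *.
  have [N _] := bounded_mul_Lp q1 f0q' (fun=> L0_measurable z) (fun=> zM).
  rewrite /Lp /finite_norm/= (ae_eq_Lnorm _ _ _ (L0_mulE f0 z)).
  - exact: (N 0%N).
  - exact: L0_measurable.
  - by apply: measurable_funM; exact: L0_measurable.
split=> v; have [iv vC] := iota_bounded v.
  by have [] := L0_hoelder p1 f0z iv.
have [_] := L0_hoelder p1 f0z iv; move=> /le_trans; apply.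
by rewrite -mulrA ler_wpM2l// Lp_norm_ge0.
Qed.

Lemma source_dual (z : L0) (M : R) : (\forall x \ae mu, `|z x| <= M) ->
  dual (source z).
Proof.
move=> /source_bound[iz zC].
by apply: bounded_linear_dual zC; exact: source_linear.
Qed.

(** The dual norm is at most |C| times the conjugate norm of [f0 * h k], which tends to zero by
    dominated convergence. *)
Lemma source_cvg0 (h : nat -> L0) (M : R) :
  (forall k, \forall x \ae mu, `|h k x| <= M) ->
  (\forall x \ae mu, h k x @[k --> \oo] --> 0) ->
  dual_norm (source (h k)) @[k --> \oo] --> 0.
Proof.
move=> hM h0; have [q q1 qE] := hoelder_conjugate_fin p1.
have f0q' := f0q; rewrite qE in f0q'.
have [_ /(_ h0) N0] := bounded_mul_Lp q1 f0q' (fun k => L0_measurable (h k)) hM.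
pose N k := Lp_norm (hoelder_conjugate p) (f0 * h k).
have {}N0 : N k * `|C| @[k --> \oo] --> 0.
  rewrite -[X in _ --> X](mul0r `|C|); apply: cvgM; last exact: cvg_cst.
  rewrite (_ : N = fun k => fine 'N[mu]_q%:E[EFin \o (fun x => f0 x * h k x)%R]%E)//.
  apply/funext => k; rewrite /N /Lp_norm qE.
  have mh : measurable_fun setT (fun x => f0 x * h k x).
    by apply: measurable_funM; exact: L0_measurable.
  by rewrite (ae_eq_Lnorm _ (L0_measurable (f0 * h k)) mh (L0_mulE f0 (h k))).
have NB k : 0 <= dual_norm (source (h k)) <= N k * `|C|.
  apply: dual_norm_bound => v v1; have [_ /(_ v)] := source_bound (hM k).
  move=> /le_trans; apply; rewrite -/(N k) -mulrA.
  rewrite ler_wpM2l ?Lp_norm_ge0// (le_trans (ler_norm _))// normrM normr_id.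
  by rewrite ler_piMr.
apply: squeeze_cvgr (cvg_cst 0) N0.
by apply: nearW => k; exact: NB.
Qed.

Variable A : {linear U -> (U -> R^o)}.
Hypothesis hA : dual_isomorphism A.

(** With [u] defined as the solution for the limit [z], A (u_k - u) = source (z - z_k); the bounded
    inverse of [A] turns convergence on the right into convergence in [U]. *)
Lemma solution_cvg (f1 : U -> R^o) (u_ : nat -> U) (z_ : nat -> L0) (z : L0)
    (M : R) : dual f1 ->
  (forall k, A (u_ k) + source (z_ k) = f1) ->
  (forall k, \forall x \ae mu, `|z_ k x| <= M) ->
  (\forall x \ae mu, `|z x| <= M) ->
  (\forall x \ae mu, z_ k x @[k --> \oo] --> z x) ->
  exists u, A u + source z = f1 /\ u_ k @[k --> \oo] --> u.
Proof.
move=> df1 Eu z_M zM z_z; case: hA => dA A_surj _ [K AK].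
have dr : dual (f1 - source z).
  exact: dual_sub df1 (source_dual zM).
have [u [Au _]] := A_surj _ dr; exists u; split; first by rewrite Au subrK.
pose h k : L0 := z - z_ k.
have iz := (source_bound zM).1.
have h2M k : \forall x \ae mu, `|h k x| <= 2 * M.
  apply: filterS2 (L0_subE z (z_ k)) (ae_bounded_sub zM (z_M k)) => x.
  by rewrite /h => ->.
have hz : \forall x \ae mu, h k x @[k --> \oo] --> 0.
  apply: filterS2 z_z (ae_foralln (fun k => L0_subE z (z_ k))) => x zx hE.
  rewrite /h; under eq_fun do rewrite hE.
  by rewrite -(subrr (z x)); apply: cvgB zx; exact: cvg_cst.
have N0 := source_cvg0 h2M hz.
have AE k : A (u_ k - u) = source (h k).
  have -> : h k = -1 *: z_ k + z by rewrite scaleN1r addrC.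
  rewrite raddfB/= Au -(Eu k).
  have [_ ->] := source_linear_comb (-1) (source_bound (z_M k)).1 iz.
  by rewrite scaleN1r opprB addrCA opprD [A (u_ k) + _]addrA subrr add0r addrC.
apply/subr_cvg0; apply/norm_cvg0P.
have KN0 : `|K| * dual_norm (source (h k)) @[k --> \oo] --> 0.
  by rewrite -[X in _ --> X](mulr0 `|K|); apply: cvgM N0; exact: cvg_cst.
apply: squeeze_cvgr (cvg_cst 0) KN0; apply: nearW => k.
rewrite normr_ge0/= (le_trans (AK _))// AE ler_wpM2r ?ler_norm//.
have [_ sB] := source_bound (h2M k).
(* Replacing [K] by its absolute value requires a nonnegative dual norm; any bound on the unit ball
   yields this. *)
have /dual_norm_bound/andP[]// : forall v : U, `|v| <= 1 ->
    `|source (h k) v| <= `|Lp_norm (hoelder_conjugate p) (f0 * h k) * C|.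
move=> v v1; rewrite (le_trans (sB v))// (le_trans (ler_norm _))// normrM.
by rewrite normr_id ler_piMr.
Qed.

End pairing.
(** * The McCormick relaxation *)

(** At a fixed point of the domain each McCormick inequality is affine in the values of [u], [w] and
    [z]; this is the form shared by all four. *)
Lemma affine_limit_le0 (R : realType) (a b c : R ^nat) (la lb lc p q r s : R) :
  a k @[k --> \oo] --> la -> b k @[k --> \oo] --> lb ->
  c k @[k --> \oo] --> lc ->
  (forall k, p * a k + q * b k + r * c k + s <= 0) ->
  p * la + q * lb + r * lc + s <= 0.
Proof.
move=> al bl cl h; have pa := cvgM (cvg_cst p) al.
have qb := cvgM (cvg_cst q) bl; have rc := cvgM (cvg_cst r) cl.
have H : p * a k + q * b k + r * c k + s @[k --> \oo] -->
    p * la + q * lb + r * lc + s.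
  apply: cvgD (cvg_cst s); apply: cvgD; last exact: rc.
  by apply: cvgD; [exact: pa|exact: qb].
by apply: (cvgr_to_le H); exact: nearW.
Qed.

Section mccormick.
Context d (T : measurableType d) (R : realType).
Variable mu : {measure set T -> \bar R}.
Local Notation L0 := {mfun_ mu, T >-> R}.
Variables ul uu wl wu : L0.
Implicit Types u w z : L0.

(** With z = uw the four inequalities are the expansions of (u - ul)(w - wl) >= 0, (uu - u)(wu - w)
    >= 0, (uu - u)(w - wl) >= 0 and (u - ul)(wu - w) >= 0. *)
Lemma mcc_product u w :
  ae_le ul u -> ae_le u uu -> ae_le wl w -> ae_le w wu ->
  mcc_le0 ul uu wl wu u w (u * w).
Proof.
move=> ulu uuu wlw wwu.
have uw : \forall x \ae mu, ul x <= u x <= uu x.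
  by apply: filterS2 ulu uuu => x -> ->.
have ww : \forall x \ae mu, wl x <= w x <= wu x.
  by apply: filterS2 wlw wwu => x -> ->.
apply: filterS3 (L0_mulE u w) uw ww => x -> /andP[u1 u2] /andP[w1 w2].
have lu : 0 <= u x - ul x by rewrite subr_ge0.
have uu' : 0 <= uu x - u x by rewrite subr_ge0.
have lw : 0 <= w x - wl x by rewrite subr_ge0.
have uw' : 0 <= wu x - w x by rewrite subr_ge0.
have := (mulr_ge0 lu lw, mulr_ge0 uu' uw', mulr_ge0 uu' lw, mulr_ge0 lu uw').
by move=> [[[h1 h2] h3] h4]; split; lra.
Qed.

Lemma mcc_convex u w z u' w' z' (t : R) : 0 <= t <= 1 ->
  mcc_le0 ul uu wl wu u w z -> mcc_le0 ul uu wl wu u' w' z' ->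
  mcc_le0 ul uu wl wu (t *: u + (1 - t) *: u') (t *: w + (1 - t) *: w')
    (t *: z + (1 - t) *: z').
Proof.
move=> /andP[t0 t1] h h'.
have E (f g : L0) : \forall x \ae mu,
    (t *: f + (1 - t) *: g : L0) x = t * f x + (1 - t) * g x.
  apply: filterS3 (L0_addE (t *: f) ((1 - t) *: g)) (L0_scaleE t f)
    (L0_scaleE (1 - t) g) => x -> -> ->.
  by [].
have hh : \forall x \ae mu,
  [/\ ul x * w x + u x * wl x - ul x * wl x - z x <= 0,
      uu x * w x + u x * wu x - uu x * wu x - z x <= 0,
      z x - uu x * w x - u x * wl x + uu x * wl x <= 0 &
      z x - ul x * w x - u x * wu x + ul x * wu x <= 0] /\
  [/\ ul x * w' x + u' x * wl x - ul x * wl x - z' x <= 0,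
      uu x * w' x + u' x * wu x - uu x * wu x - z' x <= 0,
      z' x - uu x * w' x - u' x * wl x + uu x * wl x <= 0 &
      z' x - ul x * w' x - u' x * wu x + ul x * wu x <= 0].
  by apply: filterS2 h h' => x.
have Eu := E u u'; have Ew := E w w'; have Ez := E z z'.
have : \forall x \ae mu, (t *: u + (1 - t) *: u' : L0) x =
      t * u x + (1 - t) * u' x /\
    ((t *: w + (1 - t) *: w' : L0) x = t * w x + (1 - t) * w' x /\
    (t *: z + (1 - t) *: z' : L0) x = t * z x + (1 - t) * z' x).
  by apply: filterS3 Eu Ew Ez => x.
apply: filterS2 hh => x [[a1 a2 a3 a4] [b1 b2 b3 b4]] [-> [-> ->]].
have s0 : 0 <= 1 - t by rewrite subr_ge0.
have comb p q : p <= 0 -> q <= 0 -> t * p + (1 - t) * q <= 0.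
  by move=> p0 q0; rewrite -oppr_ge0 opprD -!mulrN addr_ge0// mulr_ge0// oppr_ge0.
have := (comb _ _ a1 b1, comb _ _ a2 b2, comb _ _ a3 b3, comb _ _ a4 b4).
by move=> [[[c1 c2] c3] c4]; split; lra.
Qed.

Lemma mcc_limit (u_ w_ z_ : nat -> L0) u w z :
  (forall k, mcc_le0 ul uu wl wu (u_ k) (w_ k) (z_ k)) ->
  (\forall x \ae mu, u_ k x @[k --> \oo] --> u x) ->
  (\forall x \ae mu, w_ k x @[k --> \oo] --> w x) ->
  (\forall x \ae mu, z_ k x @[k --> \oo] --> z x) ->
  mcc_le0 ul uu wl wu u w z.
Proof.
move=> /ae_foralln h hu hw hz.
have hwz : \forall x \ae mu,
    (w_ k x @[k --> \oo] --> w x) /\ (z_ k x @[k --> \oo] --> z x).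
  by apply: filterS2 hw hz => x.
move: h hu hwz {hw hz}; apply: filterS3 => x h hu [hw hz]; split.
- have := @affine_limit_le0 _ _ _ _ _ _ _ (wl x) (ul x) (-1) (- (ul x * wl x))
    hu hw hz => H.
  suff : wl x * u x + ul x * w x + -1 * z x - ul x * wl x <= 0 by lra.
  by apply: H => k; have [h1 _ _ _] := h k; lra.
- have := @affine_limit_le0 _ _ _ _ _ _ _ (wu x) (uu x) (-1) (- (uu x * wu x))
    hu hw hz => H.
  suff : wu x * u x + uu x * w x + -1 * z x - uu x * wu x <= 0 by lra.
  by apply: H => k; have [_ h1 _ _] := h k; lra.
- have := @affine_limit_le0 _ _ _ _ _ _ _ (- wl x) (- uu x) 1 (uu x * wl x)
    hu hw hz => H.
  suff : - wl x * u x - uu x * w x + 1 * z x + uu x * wl x <= 0 by lra.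
  by rewrite -mulNr; apply: H => k; have [_ _ h1 _] := h k; lra.
- have := @affine_limit_le0 _ _ _ _ _ _ _ (- wu x) (- ul x) 1 (ul x * wu x)
    hu hw hz => H.
  suff : - wu x * u x - ul x * w x + 1 * z x + ul x * wu x <= 0 by lra.
  by rewrite -mulNr; apply: H => k; have [_ _ _ h1] := h k; lra.
Qed.

End mccormick.

(** * Convexity of the relaxed problem *)

Section McCormick_problem.
Context (R : realType) (n : nat) (Omega : lipschitz_domain R n).
Local Notation L0 := (L0 R Omega).
Local Notation mu := (dom_measure Omega).
Variables (U Y : normedModType R) (iota : {linear U -> L0}).
Variables (A : {linear U -> (U -> R^o)}) (f0 : L0) (f1 : U -> R^o).
Variables (ul uu wl wu : L0).

Lemma convex_feasible_McC (S Z : set L0) : convex_set Z ->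
  convex_set (feasible_McC iota A f0 f1 ul uu wl wu S Z).
Proof.
move=> /convex_setP cZ; apply/convex_setP.
move=> [[u w] z] [[u' w'] z'] t [[iz Eu] hm Sw Zz] [[iz' Eu'] hm' Sw' Zz'] t01.
have /convex_setP cS := @convex_convex_hull _ _ S.
split; [|by rewrite linearD !linearZ; exact: mcc_convex|exact: cS|exact: cZ].
(* A multiple alone is the case of a zero second summand, so the convex combination is reached by
   two uses of [source_linear_comb]. *)
have i0 : integrable_source iota f0 0.
  move=> v; rewrite mulr0 mul0r; apply: ae_eq_integrable (L0_zeroE mu) _.
    exact: L0_measurable.
  exact: (integrable0 mu setT).
have s0 : source iota f0 0 = 0.
  have [_] := source_linear_comb (-1) i0 i0.
  by rewrite scaler0 addr0 scaleN1r addNr.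
have := source_linear_comb (1 - t) iz' i0; rewrite s0 !addr0 => -[iz1 Ez1].
have [iz2 Ez2] := source_linear_comb t iz iz1; split.
  exact: iz2.
change (A (t *: u + (1 - t) *: u') +
  source iota f0 (t *: z + (1 - t) *: z') = f1).
rewrite Ez2 Ez1 linearD !linearZ/= addrACA -!scalerDr.
have -> : A u + source iota f0 z = f1 by [].
have -> : A u' + source iota f0 z' = f1 by [].
by rewrite -scalerDl subrKC scale1r.
Qed.

Variable O : L0 -> Y.
Hypothesis hU2 : continuous_embedding iota 2%:E.
Hypothesis hO : bounded_L2_operator O.

Lemma observation_linear : linear (O \o iota).
Proof.
move=> a u v /=; have [_ [C iC]] := hU2; have [lO _] := hO.
by rewrite linearP lO; [|exact: (iC u).1|exact: (iC v).1].
Qed.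

Lemma observation_bounded : exists K, forall u, `|O (iota u)| <= K * `|u|.
Proof.
have [_ [C iC]] := hU2; have [_ [D OD]] := hO.
exists (`|D| * `|C|) => u; have [u2 uC] := iC u.
rewrite (le_trans (OD _ u2))// -mulrA.
rewrite (@le_trans _ _ (`|D| * Lp_norm 2%:E (iota u)))//.
  by rewrite ler_wpM2r ?Lp_norm_ge0// ler_norm.
by rewrite ler_wpM2l// (le_trans uC)// ler_wpM2r// ler_norm.
Qed.

Lemma convex_objective_McC (y : Y) (F : set (U * L0 * L0)) :
  convex_function F (objective_McC iota O y).
Proof.
apply/convex_functionP => -[[u w] z] [[u' w'] z'] t _ _ /andP[t0 t1].
rewrite /objective_McC /=; set Ou := O (iota u); set Ou' := O (iota u').
have -> : O (iota (t *: u + (1 - t) *: u')) = t *: Ou + (1 - t) *: Ou'.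
  have L0 : (O \o iota) 0 = 0.
    by have := observation_linear (-1) 0 0; rewrite scaler0 addr0 scaleN1r addNr.
  have := observation_linear (1 - t) u' 0; rewrite addr0 L0 addr0 /= => E.
  by have /= -> := observation_linear t u ((1 - t) *: u'); rewrite E.
have -> : t *: Ou + (1 - t) *: Ou' - y = t *: (Ou - y) + (1 - t) *: (Ou' - y).
  rewrite !scalerBr addrACA -opprD -scalerDl subrKC scale1r//.
rewrite (le_trans (ler_normD _ _))// !normrZ !ger0_norm// subr_ge0//.
Qed.

End McCormick_problem.
(* For [p = 1] the witness is [p' = 2]: then [f0] is in L^oo, hence in L^2. *)
Lemma exponent_gt1 d (T : measurableType d) (R : realType)
    (mu : {measure set T -> \bar R}) (U : normedModType R)
    (iota : {linear U -> {mfun_ mu, T >-> R}}) (f0 : {mfun_ mu, T >-> R})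
    (p : \bar R) :
  (mu setT < +oo)%E -> continuous_embedding iota 2%:E ->
  (1 <= p)%E -> continuous_embedding iota p -> Lp (hoelder_conjugate p) f0 ->
  exists p', [/\ (1 < p')%E, continuous_embedding iota p' &
                 Lp (hoelder_conjugate p') f0].
Proof.
move=> mufin hU2; rewrite le_eqVlt => /predU1P[<-|p1]; last by exists p.
rewrite hoelder_conjugate1 => _ f0oo; exists 2%:E; split => //.
  by rewrite lte_fin; lra.
by rewrite hoelder_conjugate2; exact: Linf_Lp2.
Qed.

(** The rate 2^-k makes the distances summable, as convergence a.e. requires; [k <= s k] keeps the
    optimality gap of member s(k) below 2^-k. *)
Lemma fast_subsequence (R : realType) (V : normedModType R) (u_ : nat -> V)
    (u : V) : u_ k @[k --> \oo] --> u ->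
  exists s : nat -> nat, s k @[k --> \oo] --> \oo /\
    forall k, (k <= s k)%N /\ `|u_ (s k) - u| <= 2^-k.
Proof.
move=> u_u; have /choice[s sP] : forall k, exists m, (k <= m)%N /\
    `|u_ m - u| <= 2^-k.
  move=> k; have k0 : 0 < 2^-k :> R by rewrite invr_gt0 exprn_gt0.
  have /cvgr_distC_le/(_ _ k0)[N _ hN] := u_u.
  by exists (maxn k N); split; [exact: leq_maxl|apply: hN; exact: leq_maxr].
exists s; split => // B [N _ NB]; exists N => // k /= Nk; apply: NB => /=.
exact: leq_trans Nk (sP k).1.
Qed.

(** On a space of finite measure the L2 bound of the embedding passes to L1 norms of order 2^-k,
    which are summable. *)
Lemma embedding_ae_cvg d (T : measurableType d) (R : realType)
    (mu : {measure set T -> \bar R}) (U : normedModType R)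
    (iota : {linear U -> {mfun_ mu, T >-> R}}) (u_ : nat -> U) (u : U) :
  (mu setT < +oo)%E -> continuous_embedding iota 2%:E ->
  (forall k, `|u_ k - u| <= 2^-k) ->
  \forall x \ae mu, (iota (u_ k) : {mfun_ mu, T >-> R}) x @[k --> \oo] -->
    (iota u : {mfun_ mu, T >-> R}) x.
Proof.
move=> mufin [_ [C iC]] uk.
pose h k : {mfun_ mu, T >-> R} := iota (u_ k - u).
have hE : \forall x \ae mu, forall k, h k x =
    (iota (u_ k) : {mfun_ mu, T >-> R}) x - (iota u : {mfun_ mu, T >-> R}) x.
  apply: ae_foralln => k; rewrite /h linearB; exact: L0_subE.
have h0 : \forall x \ae mu, h k x @[k --> \oo] --> 0.
  apply: (ae_cvg0 (C := `|C| * fine (mu setT `^ 2^-1)%E)) => k.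
    exact: L0_measurable.
  have [hk2 hkC] := iC (u_ k - u).
  rewrite -(Lnorm1 mu (EFin \o (h k : T -> R))).
  rewrite (le_trans (Lnorm1_le_Lnorm2 mu (L0_measurable (h k))))//.
  have mu2 : (mu setT `^ 2^-1)%E \is a fin_num.
    by rewrite fin_num_poweR// ge0_fin_numE.
  rewrite Lp_normK// -(fineK mu2) -EFinM lee_fin mulrAC.
  rewrite ler_wpM2r ?fine_ge0 ?poweR_ge0// (le_trans hkC)//.
  by rewrite (le_trans (ler_wpM2r _ (ler_norm C)))// ler_wpM2l.
apply: filterS2 hE h0 => x hE h0.
rewrite -(add0r ((iota u : {mfun_ mu, T >-> R}) x)).
under eq_fun => k do rewrite -(subrK ((iota u : {mfun_ mu, T >-> R}) x)
  ((iota (u_ k) : {mfun_ mu, T >-> R}) x)) -hE.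
by apply: cvgD h0 _; exact: cvg_cst.
Qed.

(** * Existence of a minimizer *)

Section existence.
Context (R : realType) (n : nat) (Omega : lipschitz_domain R n).
Local Notation L0 := (L0 R Omega).
Local Notation mu := (dom_measure Omega).
Variables (U Y : normedModType R) (iota : {linear U -> L0}).
Variables (A : {linear U -> (U -> R^o)}) (f0 : L0) (f1 : U -> R^o).
Variables (ul uu wl wu : L0) (O : L0 -> Y) (y : Y) (p : \bar R).
Hypothesis hU2 : continuous_embedding iota 2%:E.
Hypothesis hp : (1 <= p)%E.
Hypothesis hUp : continuous_embedding iota p.
Hypothesis hA : dual_isomorphism A.
Hypothesis hf0 : Lp (hoelder_conjugate p) f0.
Hypothesis hf1 : dual f1.
Hypothesis hO : bounded_L2_operator O.

Lemma McC_minimizer (S V Z : set L0) (P : L0 -> L0) (Mw Mz : R) :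
  in_finite_dim_L2 V -> S `<=` V -> metric_projection S P ->
  (forall s, S s -> \forall x \ae mu, `|s x| <= Mw) ->
  weak_star_closed Z -> convex_set Z ->
  (forall z, Z z -> \forall x \ae mu, `|z x| <= Mz) ->
  feasible_McC iota A f0 f1 ul uu wl wu S Z !=set0 ->
  exists x, minimizer (objective_McC iota O y)
    (feasible_McC iota A f0 f1 ul uu wl wu S Z) x.
Proof.
move=> Vfin SV hP SM cZ convZ ZM F0.
have mufin := dom_measure_lty Omega.
set F := feasible_McC _ _ _ _ _ _ _ _ _ _ in F0 *; set J := objective_McC _ _ _.
have cF : convex_set F by exact: convex_feasible_McC.
have cJ : convex_function F J by exact: convex_objective_McC.
have Fw x : F x -> \forall t \ae mu, `|(x.1.2 : L0) t| <= Mw.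
  by case: x => [[u w] z] [_ _ Sw _]; exact: convex_hull_ae_le SM Sw.
have Fz x : F x -> \forall t \ae mu, `|(x.2 : L0) t| <= Mz.
  by case: x => [[u w] z] [_ _ _ Zz]; exact: ZM.
pose I2 (f : L0) := \int[mu]_x (f x ^+ 2).
pose dI2 (f g : L0) := \int[mu]_x ((g x - f x) ^+ 2).
pose Phi (x : U * L0 * L0) := I2 x.1.2 + I2 x.2.
pose D (x x' : U * L0 * L0) := (dI2 x.1.2 x'.1.2 + dI2 x.2 x'.2) / 4.
have I2_ge0 f : 0 <= I2 f by apply: Rintegral_ge0 => t _; exact: sqr_ge0.
have dI2_ge0 f g : 0 <= dI2 f g.
  by apply: Rintegral_ge0 => t _; exact: sqr_ge0.
have [x_ xP] : exists x : nat -> U * L0 * L0, forall k,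
    [/\ F (x k), forall y, F y -> J (x k) <= J y + 2^-k &
        D (x k) (x k.+1) <= 2^-k ^+ 2].
  apply: (@minimizing_sequence _ _ F J Phi D
    ((Mw ^+ 2 + Mz ^+ 2) * fine (mu setT))) => //.
  - by move=> x _; exact: normr_ge0.
  - move=> x Fx; rewrite /Phi addr_ge0//= mulrDl lerD//.
      by have [] := bounded_sqr_integrable mufin (L0_measurable _) (Fw _ Fx).
    by have [] := bounded_sqr_integrable mufin (L0_measurable _) (Fz _ Fx).
  - move=> x x' Fx Fx'; rewrite /Phi /D /I2 /dI2 /=.
    rewrite (midpoint_sqr_integral mufin (Fw _ Fx) (Fw _ Fx')).
    rewrite (midpoint_sqr_integral mufin (Fz _ Fx) (Fz _ Fx')).
    lra.
pose u_ k := (x_ k).1.1; pose w_ k : L0 := (x_ k).1.2; pose z_ k : L0 := (x_ k).2.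
have wM k : \forall t \ae mu, `|w_ k t| <= Mw by apply: Fw; case: (xP k).
have zM k : \forall t \ae mu, `|z_ k t| <= Mz by apply: Fz; case: (xP k).
(* The passage from small squared distances to a limit class, common to the controls and the
   products; the bound [M] survives in the limit. *)
have limit (f : nat -> L0) (M : R) :
    (forall k, \forall t \ae mu, `|f k t| <= M) ->
    (forall k, dI2 (f k) (f k.+1) <= 4 * 2^-k ^+ 2) ->
    exists2 g : L0, \forall t \ae mu, `|g t| <= M &
      \forall t \ae mu, f k t @[k --> \oo] --> g t.
  move=> fM fD; have mf k := L0_measurable (f k).
  have [G mG fG] := ae_cvg_cauchy mf (fun k => integral_norm_le_sqr mufin
    (measurable_funB (mf k.+1) (mf k)) (ae_bounded_sub (fM k.+1) (fM k)) (fD k)).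
  have [g gE] := L0_of_fun mu mG.
  have fg : \forall t \ae mu, f k t @[k --> \oo] --> g t.
    by apply: filterS2 fG gE => t + ->.
  exists g => //; apply: filterS2 fg (ae_foralln fM) => t ft fMt.
  by apply: (cvgr_to_le (cvg_norm ft)); exact: nearW.
have [w wMw w_w] : exists2 g : L0, \forall t \ae mu, `|g t| <= Mw &
    \forall t \ae mu, w_ k t @[k --> \oo] --> g t.
  apply: limit => // k; have [_ _] := xP k; rewrite /D -/(w_ k) -/(w_ k.+1).
  by have := dI2_ge0 (x_ k).2 (x_ k.+1).2; lra.
have [z zMz z_z] : exists2 g : L0, \forall t \ae mu, `|g t| <= Mz &
    \forall t \ae mu, z_ k t @[k --> \oo] --> g t.
  apply: limit => // k; have [_ _] := xP k; rewrite /D -/(z_ k) -/(z_ k.+1).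
  by have := dI2_ge0 (x_ k).1.2 (x_ k.+1).1.2; lra.
have Fx k : [/\ state_eq iota A f0 f1 (u_ k) (z_ k),
    mcc_le0 ul uu wl wu (iota (u_ k)) (w_ k) (z_ k), convex_hull S (w_ k) &
    Z (z_ k)].
  by have [Fk _ _] := xP k; move: Fk; rewrite /F /u_ /w_ /z_; case: (x_ k) => -[].
have Zz : Z z.
  by apply: (weak_star_closed_ae (z_ := z_) cZ _ zM zMz z_z) => k; case: (Fx k).
have Sw : convex_hull S w.
  by apply: (closed_convex_hull mufin Vfin SV hP SM _ w_w) => k; case: (Fx k).
(* The exponent is replaced by some q > 1, whose conjugate is finite. *)
have [q [q1 [_ [C iC]] f0q]] := exponent_gt1 mufin hU2 hp hUp hf0.
have [u [Eu u_u]] : exists u, A u + source iota f0 z = f1 /\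
    u_ k @[k --> \oo] --> u.
  apply: (solution_cvg q1 iC f0q hA hf1 _ zM zMz z_z) => k.
  by have [[_ Ek] _ _ _] := Fx k.
(* [w_] and [z_] already converge a.e.; only the states, known to converge in norm, need a
   subsequence for convergence a.e. *)
have [s [s_oo sP]] := fast_subsequence u_u.
have [_ [C2 iC2]] := hU2.
have iu : \forall t \ae mu,
    (iota (u_ (s k)) : L0) t @[k --> \oo] --> (iota u : L0) t.
  exact: embedding_ae_cvg mufin hU2 (fun k => (sP k).2).
have [K OK] := observation_bounded hU2 hO.
have sub (f : nat -> L0) g :
    (\forall t \ae mu, f k t @[k --> \oo] --> g t) ->
    \forall t \ae mu, f (s k) t @[k --> \oo] --> g t.
  by apply: filterS => t ft; exact: cvg_comp s_oo ft.
exists (u, w, z); split.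
  split => //.
    by split => //; exact: (source_bound q1 iC f0q zMz).1.
  apply: (mcc_limit (u_ := fun k => iota (u_ (s k))) (w_ := w_ \o s)
    (z_ := z_ \o s)) => [k|//||]; first by case: (Fx (s k)).
    exact: sub.
  exact: sub.
(* At member s(k) the optimality gap is at most 2^-k and passing to the limit state changes the
   objective by at most |K| 2^-k, whence 1 + |K|. *)
move=> x' Fx'; apply: (@le_of_expn _ _ _ (1 + `|K|)) => k.
have [_ /(_ _ Fx') Jk _] := xP (s k).
have [ks us] := sP k.
have JK : J (u, w, z) <= J (x_ (s k)) + `|K| * 2^-k.
  have -> : u = -1 *: (u_ (s k) - u) + u_ (s k) by rewrite scaleN1r opprB subrK.
  rewrite /J /objective_McC /=.
  have /= -> := observation_linear hU2 hO (-1) (u_ (s k) - u) (u_ (s k)).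
  rewrite -addrA addrC (le_trans (ler_normD _ _))// lerD2l scaleN1r normrN.
  rewrite (le_trans (OK _))// (le_trans (ler_wpM2r _ (ler_norm K)))//.
  by rewrite ler_wpM2l.
apply: (le_trans JK); rewrite mulrDl mul1r addrA lerD2r.
apply: (le_trans Jk); rewrite lerD2l lef_pV2 ?posrE ?exprn_gt0//.
by rewrite ler_weXn2l// ler1n.
Qed.

End existence.
Theorem proposition3p11 (R : realType)
  (* the dimension d of the ambient space is n.+1 *)
  (n : nat) (Omega : lipschitz_domain R n)
  (U : completeNormedModType R) (hU : is_reflexive U)
  (iota : {linear U -> L0 R Omega})
  (hU2 : continuous_embedding iota 2%:E)
  (p : \bar R) (hp : (1 <= p)%E) (hUp : continuous_embedding iota p)
  (A : {linear U -> (U -> R^o)}) (hA : dual_isomorphism A)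
  (f0 : L0 R Omega) (hf0 : Lp (hoelder_conjugate p) f0) (hf0_ge0 : ae_le 0 f0)
  (f1 : U -> R^o) (hf1 : dual f1)
  (Y : completeNormedModType R) (T : L0 R Omega -> Y)
  (hT : bounded_L2_operator T) (ydelta : Y)
  (wl wu : L0 R Omega) (hwl : Lp +oo wl) (hwu : Lp +oo wu)
  (Wad : set (L0 R Omega)) (hWad0 : Wad !=set0)
  (hWad : forall w, Wad w -> [/\ Lp +oo w, ae_le wl w & ae_le w wu])
  (Qh Qtau : mesh Omega) (h tau : R)
  (hh : h = mesh_size Qh) (htau : tau = mesh_size Qtau)
  (Vh : set (L0 R Omega)) (PVh PWh : L0 R Omega -> L0 R Omega)
  (hPVh : metric_projection Vh PVh)
  (hPWh : metric_projection (Wad `&` Vh) PWh)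
  (A1_dim : in_finite_dim_L2 Vh) (A1_closed : closed_in_Lp 2%:E Vh)
  (A1_convex : convex_set Vh)
  (A2 : forall w, Wad w ->
     (exists! u, solves_E iota A f0 f1 u w) /\
     (exists! u, solves_E_tau iota A f0 f1 Qtau u w))
  (ul uu : L0 R Omega) (hul : Lp +oo ul) (huu : Lp +oo uu)
  (A3 : forall w u, Wad w -> solves_E iota A f0 f1 u w ->
     ae_le ul (iota u) /\ ae_le (iota u) uu)
  (A4 : exists uli uui : 'I_(mesh_card Qtau) -> R,
     forall w u, Wad w -> solves_E_tau iota A f0 f1 Qtau u w ->
       cell_bounds uli uui (local_average Qtau (iota u)))
  (A5 : exists wli wui : 'I_(mesh_card Qtau) -> R,
     forall w, (Wad `&` Vh) w -> cell_bounds wli wui (local_average Qtau w))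
  (A6 : forall w, Wad w -> PVh w = PWh w)
  (Zad : set (L0 R Omega)) (A7_Linfty : Zad `<=` Lp +oo)
  (A7_closed : weak_star_closed Zad) (A7_convex : convex_set Zad)
  (A7_bounded : bounded_in_Lp +oo Zad)
  (A7 : forall w u, (Wad `&` Vh) w -> solves_E iota A f0 f1 u w ->
     Zad (iota u * w))
  (Ztau : set (L0 R Omega)) (A8_Linfty : Ztau `<=` Lp +oo)
  (A8_closed : closed_in_Lp +oo Ztau) (A8_convex : convex_set Ztau)
  (A8_bounded : bounded_in_Lp +oo Ztau)
  (A8_pc : forall z, Ztau z -> piecewise_constant Qtau z)
  (A8 : forall w u, (Wad `&` Vh) w -> solves_E_tau iota A f0 f1 Qtau u w ->
     Ztau (local_average Qtau (iota u) * local_average Qtau w)) :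
  let F_I := feasible_I iota A f0 f1 (Wad `&` Vh) in
  let J_I := objective_I iota T ydelta in
  let F_McC := feasible_McC iota A f0 f1 ul uu wl wu (Wad `&` Vh) Zad in
  let J_McC := objective_McC iota T ydelta in
  [/\ convex_minimization_problem J_McC F_McC,
      exists x, minimizer J_McC F_McC x &
      forall u w, F_I (u, w) ->
        [/\ (Wad `&` Vh) w, Zad (iota u * w), F_McC (u, w, iota u * w) &
            J_McC (u, w, iota u * w) = J_I (u, w)]].
Proof.
set Wh := Wad `&` Vh; cbv zeta.
(* Besides being the last claim, this turns a control and its state into a feasible point of the
   relaxation. *)
have feas u w : feasible_I iota A f0 f1 Wh (u, w) ->
    [/\ Wh w, Zad (iota u * w),
        feasible_McC iota A f0 f1 ul uu wl wu Wh Zad (u, w, iota u * w) &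
        objective_McC iota T ydelta (u, w, iota u * w) =
        objective_I iota T ydelta (u, w)].
  move=> [Euw Whw]; have [Ww Vw] := Whw; have Zuw := A7 _ _ Whw Euw.
  have [lw wlw wwu] := hWad _ Ww; have [lu uu'] := A3 _ _ Ww Euw.
  split => //; split => //; first exact: mcc_product.
  exact: convex_hull_sub.
(* A control lies between [wl] and [wu], so the sum of their norms bounds it. *)
have WhM s : Wh s ->
    \forall x \ae dom_measure Omega, `|s x| <= Lp_norm +oo wl + Lp_norm +oo wu.
  move=> [/hWad[_ wls swu] _].
  have : \forall x \ae dom_measure Omega, wl x <= s x <= wu x.
    by apply: filterS2 wls swu => x -> ->.
  apply: filterS3 (Linf_ae_le hwl) (Linf_ae_le hwu) => x.
  rewrite !ler_norml => /andP[l1 l2] /andP[v1 v2] /andP[s1 s2].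
  by apply/andP; split; lra.
have [Mz ZM] : exists M, forall z, Zad z ->
    \forall x \ae dom_measure Omega, `|z x| <= M.
  have [M zM] := A7_bounded; exists M => z Zz.
  by apply: filterS (Linf_ae_le (A7_Linfty _ Zz)) => x /le_trans; apply; exact: zM.
(* The projection of 0 is an admissible discrete control, and the state that (A2) gives it yields a
   feasible triple. That 0 belongs to L2 is read off from iota 0 = 0. *)
have F0 : feasible_McC iota A f0 f1 ul uu wl wu Wh Zad !=set0.
  have L20 : Lp 2%:E (0 : L0 R Omega).
    by rewrite -(linear0 iota); have [_ [C iC]] := hU2; exact: (iC 0).1.
  have [Wh0 _] := hPWh _ L20.
  have [[u [Eu _]] _] := A2 _ Wh0.1.
  by have [] := feas u _ (conj Eu Wh0); exists (u, PWh 0, iota u * PWh 0).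
split => //; first split.
- exact: convex_feasible_McC.
- exact: convex_objective_McC.
- have WV : Wh `<=` Vh by move=> w [].
  exact: (McC_minimizer ydelta hU2 hp hUp hA hf0 hf1 hT A1_dim WV hPWh WhM
    A7_closed A7_convex ZM F0).
Qed.
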